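(* Let $r\ge 1$ be an integer and set $L(r)=\dfrac{(r+1)^{r+1}}{r^r}>0$. Let $F_{\langle r\rangle}$ be the probability distribution on $\mathbb{R}$ with moments $\int_{\mathbb{R}}x^k\,dF_{\langle r\rangle}(x)=\frac{1}{k+1}\binom{(r+1)k}{k}$, $k=0,1,2,\dots$. Then: (i) The Stieltjes–Cauchy transform $G_{\langle r\rangle}(z):=\int_{\mathbb{R}}\frac{1}{z-x}\,dF_{\langle r\rangle}(x)$, $z\in\mathbb{C}\setminus[0,L(r)]$, has the hypergeometric representation $$G_{\langle r\rangle}(z)=\frac{1}{r+1}\left(1-{}_{r}F_{r-1}\left[\begin{matrix}-\frac{1}{r+1},-\frac{2}{r+1},\ldots,-\frac{r}{r+1}\\ -\frac1r,-\frac2r,\ldots,-\frac{r-1}{r}\end{matrix};\frac{L(r)}{z}\right]\right).$$ (ii) If $Y_{\langle r\rangle}$ is a real random variable with distribution $F_{\langle r\rangle}$, then the following identity in distribution holds: $$Y_{\langle r\rangle}\overset{\mathrm d}{=}\mathrm{U}(0,L(r))\prod_{j=1}^{r}\mathrm{B}\left(\frac{j}{r+1},\frac{j}{r(r+1)}\right),$$ where the random variables on the right-hand side are jointly independent. (iii) Let $\mathrm U,\mathrm U'$ be independent random variables uniformly distributed on $[0,1]$, and let $A_{\langle r\rangle}=e^{(r-1)\pi \mathrm{i}\,\mathrm U'}\,(2\cos\pi \mathrm U')^{r+1}$, where $\mathrm{i}$ is the imaginary unit. Then for every $k=0,1,2,\dots$, $$\mathbb{E}\,Y_{\langle r\rangle}^k=\mathbb{E}\left(\mathrm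 U\,A_{\langle r\rangle}\right)^k .$$
   Context: $F_{\langle r\rangle}$ is uniquely determined by its moments. $\mathrm{U}(0,\ell)$ denotes a random variable uniformly distributed on $[0,\ell]$. $\mathrm{B}(a,b)$, with $a,b>0$, denotes a beta random variable, supported on $[0,1]$ with density $\frac{\Gamma(a+b)}{\Gamma(a)\Gamma(b)}x^{a-1}(1-x)^{b-1}$. ${}_pF_q$ denotes the generalised hypergeometric function, ${}_pF_q\left[\begin{smallmatrix}a_1,\dots,a_p\\ b_1,\dots,b_q\end{smallmatrix};w\right]=\sum_{n\ge0}\frac{(a_1)_n\cdots(a_p)_n}{(b_1)_n\cdots(b_q)_n}\frac{w^n}{n!}$ with $(a)_n=a(a+1)\cdots(a+n-1)$; for $p=q+1$ the series converges for $|w|<1$ and ${}_{q+1}F_q$ denotes its analytic continuation to $\mathbb{C}\setminus[1,\infty)$. For $r=1$ the list of lower parameters is empty. *)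

(* Defs.v *)
(* C is R[i] for an arbitrary realType R; its topology is carried by R[i]^o. *)
From HB Require Import structures.
From mathcomp Require Import all_boot all_order all_algebra complex.
From mathcomp Require Import all_classical all_reals all_analysis.

Set Implicit Arguments.
Unset Strict Implicit.
Unset Printing Implicit Defensive.

Import Order.TTheory GRing.Theory Num.Theory.
Import numFieldNormedType.Exports.

Local Open Scope classical_set_scope.
Local Open Scope complex_scope.
Local Open Scope ring_scope.

Definition Lr (R : realType) (r : nat) : R :=
  r.+1%:R ^+ r.+1 / r%:R ^+ r.

Lemma Lr_gt0 (R : realType) (r : nat) : 0 < Lr R r.
Proof.
by apply: divr_gt0; [|case: r => [|r]]; rewrite ?expr0// exprn_gt0.
Qed.

Definition rising (R : realType) (a : R[i]) (n : nat) : R[i] :=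
  \prod_(k < n) (a + k%:R).

Definition hyper_term (R : realType) (a b : seq R[i]) (w : R[i]) (n : nat)
    : R[i] :=
  (\prod_(x <- a) rising x n) / (\prod_(y <- b) rising y n)
    * (w ^+ n / n`!%:R).

Definition analytic_at (R : realType) (f : R[i] -> R[i]) (z : R[i]) : Prop :=
  exists c : nat -> R[i], \forall w \near (z : R[i]^o),
    series (fun n => c n * (w - z) ^+ n : R[i]^o) @ \oo --> (f w : R[i]^o).

Definition slit_plane (R : realType) : set R[i] :=
  ~` [set x%:C | x in `[(1 : R), +oo[].

(* The order and the norm of R[i] take values in R[i]: `|w| < 1 says that the
   modulus of w is less than 1. *)
Definition is_hypergeometric (R : realType) (a b : seq R[i])
    (H : R[i] -> R[i]) : Prop :=
  (forall w, `|w| < 1 ->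
    series (hyper_term a b w : nat -> R[i]^o) @ \oo --> (H w : R[i]^o)) /\
  (forall w, slit_plane w -> analytic_at H w).

(* Analytic continuation to C \ [1, +oo[ of the series with upper parameters a
   and lower parameters b, meant for size a = (size b).+1.  By the identity
   theorem it is unique on slit_plane; its values outside are arbitrary. *)
Definition hypergeometric (R : realType) (a b : seq R[i]) : R[i] -> R[i] :=
  xget (fun=> 0) [set H | is_hypergeometric a b H].

Definition cintegrable d (T : measurableType d) (R : realType)
    (mu : {measure set T -> \bar R}) (f : T -> R[i]) : Prop :=
  mu.-integrable setT (fun t => (complex.Re (f t))%:E) /\
  mu.-integrable setT (fun t => (complex.Im (f t))%:E).

(* Only meaningful when cintegrable mu f. *)
Definition cintegral d (T : measurableType d) (R : realType)
    (mu : {measure set T -> \bar R}) (f : T -> R[i]) : R[i] :=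
  (\int[mu]_t complex.Re (f t)) +i* (\int[mu]_t complex.Im (f t)).

Definition cauchy_transform (R : realType)
    (F : probability (measurableTypeR R) R) (z : R[i]) : R[i] :=
  cintegral F (fun x : R => (z - x%:C)^-1).

(* Measures are total functions on sets, so two laws must only be compared on
   measurable sets. *)
Definition eq_law (R : realType)
    (mu nu : set (measurableTypeR R) -> \bar R) : Prop :=
  forall A, measurable A -> mu A = nu A.

Definition independent d (T : measurableType d) (R : realType)
    (P : probability T R) (I : finType) (X : I -> T -> R) : Prop :=
  forall (J : {set I}) (A : I -> set (measurableTypeR R)),
    (forall i, measurable (A i)) ->
    P (\bigcap_(i in [set` J]) (X i @^-1` A i))
      = (\prod_(i in J) P (X i @^-1` A i))%E.

Definition Gamma (R : realType) (a : R) : R :=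
  \int[@lebesgue_measure R]_(x in `]0, +oo[) (x `^ (a - 1) * expR (- x)).

Definition beta_density (R : realType) (a b x : R) : R :=
  if 0 < x < 1 then
    Gamma (a + b) / (Gamma a * Gamma b) * x `^ (a - 1) * (1 - x) `^ (b - 1)
  else 0.

(* The library's beta_prob only takes natural parameters. *)
Definition beta_law (R : realType) (a b : R) (A : set (measurableTypeR R))
    : \bar R :=
  (\int[@lebesgue_measure R]_(x in A) (beta_density a b x)%:E)%E.

Definition cexp (R : realType) (z : R[i]) : R[i] :=
  (expR (complex.Re z))%:C * (cos (complex.Im z) +i* sin (complex.Im z)).

Definition A_ (R : realType) (r : nat) (u : R) : R[i] :=
  cexp (((r%:R - 1) * pi)%:C * 'i%C * u%:C)
    * ((2 * cos (pi * u)) ^+ r.+1)%:C.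

(* Main.v *)
(* The moments of F are L^k/(k+1) times a product of beta moments, where
   L = (r+1)^(r+1)/r^r.  Integrating one beta density after the other shows
   that the linear functional determined by the numbers m_k/L^k is nonnegative
   on polynomials that are nonnegative on [0,1].  Applied to 1 - (2x-1)^(2n),
   this and Markov's inequality force every law with these moments to live on
   [0,L]; Bernstein polynomials then show that such a law is unique, which
   gives (ii) since the product in (ii) has the same moments.

   For (i), the function H(w) = 1 - (r+1) int w/(L - w x) dF(x) is analytic off
   [1,+oo[ and expands at 0 as the hypergeometric series, hence it is the
   analytic continuation by the identity theorem along rays from 0; the claim
   is the substitution w = L/z.

   For (iii), 2 cos t = e^(it) + e^(-it), so that A^k is a trigonometric
   polynomial in 2 pi U' whose constant term is C((r+1)k, k). *)
Require Import Defs.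
From HB Require Import structures.
From mathcomp Require Import all_boot all_order all_algebra complex.
From mathcomp Require Import all_classical all_reals all_analysis.
From mathcomp Require Import measurable_realfun ring lra finmap.

Set Implicit Arguments.
Unset Strict Implicit.
Unset Printing Implicit Defensive.

Import Order.TTheory GRing.Theory Num.Theory.
Import numFieldNormedType.Exports.

Local Open Scope classical_set_scope.
Local Open Scope complex_scope.
Local Open Scope ring_scope.

(** * The complex plane through real moduli *)

(** The hypothesis on F concerns its moments alone, while the Cauchy transform requires its support.
    A product variable as in (ii) would reveal the support, but the statement only quantifies over
    such variables and supplies none; the positive functional on polynomials replaces it and asks
    for one-dimensional beta integrals only. The factor 1/(k+1) is the k-th moment of the uniform
    law on [0,1], that is of B(1,1), and so counts as one more beta factor. The support result
    applies to any law with these moments, hence both to F and to the law of a given product in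
    (ii). In (i) the function H does double duty: it shows that an analytic continuation exists,
    without which [hypergeometric] would be an arbitrary default, and it is then compared with the
    continuation that was picked. Its analytic properties all come from the Taylor expansion of w/(L
    - w x) in w, which is geometric and uniform in x on [0, L]. Estimates use the real modulus
    [modc], because the norm of R[i] takes values in R[i]. *)

Definition modc (R : realType) (z : R[i]) : R := complex.Re `|z|.

Section Modulus.
Variable R : realType.
Implicit Types (z w : R[i]) (x : R).

Lemma modcE z : `|z| = (modc z)%:C.
Proof. by rewrite /modc normc_def. Qed.

Lemma modc_ge0 z : 0 <= modc z.
Proof. by rewrite -lecR -modcE normr_ge0. Qed.

Lemma modcM z w : modc (z * w) = modc z * modc w.
Proof. by apply: complexI; rewrite rmorphM/= -!modcE normrM. Qed.

Lemma modcV z : modc z^-1 = (modc z)^-1.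
Proof. by apply: complexI; rewrite fmorphV/= -!modcE normfV. Qed.

Lemma modcX z n : modc (z ^+ n) = modc z ^+ n.
Proof. by apply: complexI; rewrite rmorphXn/= -!modcE normrX. Qed.

Lemma modcN z : modc (- z) = modc z.
Proof. by rewrite /modc normrN. Qed.

Lemma modcB z w : modc (z - w) = modc (w - z).
Proof. by rewrite -modcN opprB. Qed.

Lemma modcD z w : modc (z + w) <= modc z + modc w.
Proof. by rewrite -lecR rmorphD/= -!modcE ler_normD. Qed.

Lemma modc_real x : modc x%:C = `|x|.
Proof. by rewrite /modc normc_def/= expr0n/= addr0 sqrtr_sqr. Qed.

Lemma modc0 : modc (0 : R[i]) = 0.
Proof. by rewrite /modc normr0. Qed.

Lemma modc_eq0 z : (modc z == 0) = (z == 0).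
Proof. by rewrite -(normr_eq0 z) modcE -(inj_eq (@complexI R)). Qed.

Lemma modc_gt0 z : (0 < modc z) = (z != 0).
Proof. by rewrite lt_neqAle modc_ge0 andbT eq_sym modc_eq0. Qed.

Lemma sqr_modc z : modc z ^+ 2 = complex.Re z ^+ 2 + complex.Im z ^+ 2.
Proof. by apply: complexI; rewrite rmorphXn/= -modcE -add_Re2_Im2. Qed.

Lemma ler_Re_modc z : `|complex.Re z| <= modc z.
Proof.
rewrite -(@ler_pXn2r _ 2)// ?nnegrE ?modc_ge0 ?normr_ge0// sqr_modc.
by rewrite real_normK ?num_real// lerDl sqr_ge0.
Qed.

Lemma ler_Im_modc z : `|complex.Im z| <= modc z.
Proof.
rewrite -(@ler_pXn2r _ 2)// ?nnegrE ?modc_ge0 ?normr_ge0// sqr_modc.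
by rewrite real_normK ?num_real// lerDr sqr_ge0.
Qed.

Lemma ler_modc z : modc z <= `|complex.Re z| + `|complex.Im z|.
Proof.
rewrite -(@ler_pXn2r _ 2)// ?nnegrE ?modc_ge0 ?addr_ge0 ?normr_ge0// sqr_modc.
rewrite sqrrD !real_normK ?num_real//.
have : 0 <= `|complex.Re z| * `|complex.Im z| by rewrite mulr_ge0.
lra.
Qed.

(** In [R[i]^o] the tolerances are complex numbers too; a positive one has zero imaginary part, so
    real tolerances give the same convergence. *)
Lemma cvg_modcP (u : nat -> R[i]) l :
  ((u : nat -> R[i]^o) @ \oo --> (l : R[i]^o)) <->
  (forall e, 0 < e -> exists N, forall n, (N <= n)%N -> modc (u n - l) < e).
Proof.
split=> [/cvgrPdist_lt ul e e0|ul].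
- have [|N _ hN] := ul e%:C; first by rewrite ltcR.
  by exists N => n /hN; rewrite /= distrC modcE ltcR.
- apply/cvgrPdist_lt => /= -[e e']; rewrite lt_def => /andP[e0].
  rewrite lecE/= => /andP[/eqP e'0 e_ge0]; move: e0; rewrite e'0 => e0.
  have {}e0 : 0 < e.
    rewrite lt_neqAle e_ge0 andbT; apply: contra e0 => /eqP <-.
    by rewrite eq_complex/= !eqxx.
  have [N hN] := ul _ e0; exists N => // n /= /hN; rewrite distrC modcE.
  by rewrite -ltcR.
Qed.

Lemma near_modcP (P : R[i] -> Prop) z :
  (\forall w \near (z : R[i]^o), P w) <->
  (exists2 e, 0 < e & forall w, modc (w - z) < e -> P w).
Proof.
split=> [/nbhs_ballP[e /= e0 he]|[e e0 he]].
- have eE : e = (complex.Re e)%:C.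
    by move: e0; case: (e) => a b /=; rewrite ltcE/= => /andP[/eqP->].
  exists (complex.Re e); first by rewrite -ltcR -eE.
  by move=> w we; apply: he; rewrite /ball/= distrC modcE eE ltcR.
- apply/nbhs_ballP; exists e%:C; first by rewrite /= ltcR.
  by move=> w; rewrite /ball/= distrC modcE ltcR => /he.
Qed.

End Modulus.

(** * Identity theorem on the slit plane *)

Section IdentityTheorem.
Variable R : realType.
Implicit Types (f g : R[i] -> R[i]) (z w : R[i]).

Lemma analytic_atB f g z : analytic_at f z -> analytic_at g z ->
  analytic_at (fun w => f w - g w) z.
Proof.
move=> [c cf] [d dg]; exists (fun n => c n - d n).
apply: filterS2 cf dg => w cw dw.
apply/cvg_modcP => e e0; have e2 : 0 < e / 2 by rewrite divr_gt0.
move/cvg_modcP : cw => /(_ _ e2)[N1 h1]; move/cvg_modcP : dw => /(_ _ e2)[N2 h2].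
exists (maxn N1 N2) => n; rewrite geq_max => /andP[/h1 {}h1 /h2 {}h2].
rewrite (_ : series _ n = series (fun n => c n * (w - z) ^+ n) n
    - series (fun n => d n * (w - z) ^+ n) n :> R[i]); last first.
  by rewrite /series/= -sumrB; apply: eq_bigr => k _; rewrite mulrBl.
rewrite opprD addrACA -opprD (le_lt_trans (modcD _ _))// modcN.
by move: h1 h2; lra.
Qed.

(** Each term is a difference of consecutive partial sums. Once these are within 1 of the limit the
    terms are at most 2; the finitely many earlier terms are added to the bound. *)
Lemma power_series_coef_bound (c : nat -> R[i]) (rho : R) l : 0 < rho ->
  series (fun n => c n * rho%:C ^+ n : R[i]^o) @ \oo --> (l : R[i]^o) ->
  exists2 M, 0 < M & forall n, modc (c n) * rho ^+ n <= M.
Proof.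
move=> rho0 /cvg_modcP/(_ 1 ltr01)[N hN].
have E n : modc (c n) * rho ^+ n = modc (c n * rho%:C ^+ n).
  by rewrite modcM modcX modc_real gtr0_norm.
exists (2 + \sum_(n < N) modc (c n) * rho ^+ n).
  rewrite ltr_wpDr// sumr_ge0// => i _.
  by rewrite mulr_ge0 ?modc_ge0// exprn_ge0// ltW.
move=> n; have [nN|Nn] := ltnP n N.
  rewrite (bigD1 (Ordinal nN))//= addrCA lerDl addr_ge0// sumr_ge0// => i _.
  by rewrite mulr_ge0 ?modc_ge0// exprn_ge0// ltW.
apply: (@le_trans _ _ 2); last first.
  rewrite lerDl sumr_ge0// => i _.
  by rewrite mulr_ge0 ?modc_ge0// exprn_ge0// ltW.
rewrite E; set s := series _ in hN.
rewrite [c n * _](_ : _ = (s n.+1 - l) + - (s n - l)); last first.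
  by rewrite opprB addrA subrK /s seriesSB.
rewrite (le_trans (modcD _ _))// modcN.
have := hN _ Nn; have := hN _ (leqW Nn); lra.
Qed.

(** For q at most 1/2, q^k is dominated by the increment of -2 q^k at k, so the sum telescopes. *)
Lemma sum_expr_le (q : R) m N : 0 <= q <= 2^-1 ->
  \sum_(m.+1 <= n < N) q ^+ n <= 2 * q ^+ m.+1.
Proof.
move=> /andP[q0 q1]; have [Nm|mN] := leqP N m.+1.
  by rewrite big_geq// mulr_ge0// exprn_ge0.
pose g n : R := - (2 * q ^+ n).
have H k : q ^+ k <= g k.+1 - g k.
  rewrite /g exprS opprK.
  have : q * q ^+ k <= 2^-1 * q ^+ k by rewrite ler_wpM2r// exprn_ge0.
  lra.
apply: (@le_trans _ _ (\sum_(m.+1 <= k < N) (g k.+1 - g k))).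
  by apply: ler_sum => k _; exact: H.
rewrite telescope_sumr; last exact: ltnW.
rewrite /g opprK gerDr.
by rewrite oppr_le0 mulr_ge0// exprn_ge0.
Qed.

(* If c_m is the first nonzero coefficient, the terms of order > m are
   O(|w - z|^(m+1)), which a zero of f close to z contradicts. *)
Lemma analytic_at_zero f z : analytic_at f z ->
  (forall e, 0 < e -> exists w, [/\ w != z, modc (w - z) < e & f w = 0]) ->
  exists2 e, 0 < e & forall w, modc (w - z) < e -> f w = 0.
Proof.
move=> [c /near_modcP[e e0 he]] acc.
pose rho := e / 2.
have rho0 : 0 < rho by rewrite divr_gt0.
have [M M0 hM] : exists2 M, 0 < M & forall n, modc (c n) * rho ^+ n <= M.
  have := he (z + rho%:C); rewrite addrC addKr modc_real gtr0_norm//.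
  have rhoe : rho < e by rewrite /rho; lra.
  by move=> /(_ rhoe); exact: power_series_coef_bound.
have c0 n : c n = 0.
  have [m] := ubnP n; elim: m n => // m IH n; rewrite ltnS => nm.
  have {nm}cl k : (k < n)%N -> c k = 0.
    by move=> kn; apply: IH; exact: leq_trans kn nm.
  apply/eqP; apply/negPn/negP => cn0.
  have cn : 0 < modc (c n) by rewrite modc_gt0.
  (* The first bound makes the ratio q = |w - z|/rho at most 1/2, as the geometric tail estimate
     requires; the second makes the tail bound 2 M q^(n+1) smaller than the leading term. *)
  pose d := Num.min (rho / 2) (modc (c n) * rho ^+ n.+1 / (2 * M)).
  have d0 : 0 < d.
    by rewrite /d lt_min !divr_gt0// ?mulr_gt0// ?exprn_gt0.
  have [w [wz wd fw]] := acc _ d0.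
  have {wz}h0 : 0 < modc (w - z) by rewrite modc_gt0 subr_eq0.
  move: wd; rewrite /d lt_min => /andP[].
  set h := modc (w - z) in h0 * => h1 h2.
  pose q := h / rho.
  have q01 : 0 <= q <= 2^-1.
    rewrite /q divr_ge0 ?(ltW h0) ?(ltW rho0)//= ler_pdivrMr//; lra.
  have : modc (c n) * h ^+ n <= M * (2 * q ^+ n.+1).
    (* [t] absorbs the distance between a partial sum and its limit f w = 0; the partial sum is
       taken long enough to contain the term of order n. *)
    apply/ler_addgt0Pl => /= t t0; set b := M * _.
    have we : modc (w - z) < e by rewrite -/h; move: h1 h0 e0; rewrite /rho; lra.
    have /cvg_modcP/(_ _ t0)[N] := he w we.
    move=> /(_ (maxn N n.+1) (leq_maxl _ _)); rewrite fw.
    rewrite subr0 /series/=.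
    rewrite (big_cat_nat (n := n.+1))//= ?leq_maxr// big_nat_recr//=.
    rewrite big_nat big1 ?add0r; last first.
      by move=> k /andP[_ kn]; rewrite cl ?mul0r.
    set T := \sum_(_ <= _ < _) _ => hT.
    have T1 : modc T <= b.
      rewrite /b mulrA /T; apply: (@le_trans _ _
        (\sum_(n.+1 <= k < maxn N n.+1) M * q ^+ k)).
        elim/big_ind2 : _ => [|x a y a' xa ya|k _]; first by rewrite modc0.
          by rewrite (le_trans (modcD _ _))// lerD.
        rewrite modcM modcX -/h /q expr_div_n mulrA.
        by rewrite ler_pdivlMr ?exprn_gt0// mulrAC ler_wpM2r// exprn_ge0// ltW.
      by rewrite -mulr_sumr -mulrA ler_wpM2l ?(ltW M0)// sum_expr_le.
    have : modc (c n * (w - z) ^+ n) <= modc (c n * (w - z) ^+ n + T) + modc T.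
      rewrite -[in leLHS](addrK T (c n * _)) (le_trans (modcD _ _))//.
      by rewrite modcN.
    rewrite modcM modcX -/h => /le_trans; apply.
    move: hT T1; set X := modc (_ + T) => hT T1.
    have := ltW hT; lra.
  rewrite leNgt => /negP; apply.
  have -> : M * (2 * q ^+ n.+1) = M * 2 * h / rho ^+ n.+1 * h ^+ n.
    by rewrite /q expr_div_n (exprS h) !mulrA [RHS]mulrAC.
  rewrite ltr_pM2r ?exprn_gt0// ltr_pdivrMr ?exprn_gt0//.
  by move: h2; rewrite ltr_pdivlMr ?mulr_gt0// mulrC [M * 2]mulrC.
exists e => // w /he/cvg_modcP hw; apply/eqP; rewrite -modc_eq0 eq_le modc_ge0.
rewrite andbT; apply/ler_addgt0Pl => t t0; rewrite addr0; have [N /(_ _ (leqnn _))] := hw _ t0.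
rewrite /series/= big1 => [|k _]; last by rewrite c0 mul0r.
by rewrite sub0r modcN => /ltW.
Qed.

(** The slit plane is star-shaped about 0, so the segment from 0 to w stays inside it. *)
Lemma slit_plane_scale (t : R) w : 0 <= t <= 1 -> slit_plane w ->
  slit_plane (t%:C * w).
Proof.
move=> /andP[t0 t1] sw [x]; rewrite /= in_itv/= andbT => x1 xE; apply: sw.
have t_gt0 : 0 < t.
  rewrite lt_neqAle t0 andbT; apply/eqP => t00.
  by move: xE x1; rewrite -t00 mul0r => /complexI ->; rewrite ler10.
exists (x / t).
  by rewrite /= in_itv/= andbT ler_pdivlMr// mul1r (le_trans t1).
by rewrite rmorphM fmorphV/= xE mulrAC mulfV ?mul1r// fmorph_eq0 gt_eqF.
Qed.

(** Let t0 be the supremum of the t such that f vanishes on the segment from 0 to t w. The zeros s w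
    with s < t0 accumulate at t0 w, so f vanishes near that point, and the segment could be
    prolonged unless t0 = 1. *)
Lemma slit_plane_identity f :
  (forall w, slit_plane w -> analytic_at f w) ->
  (forall w, modc w < 1 -> f w = 0) ->
  forall w, slit_plane w -> f w = 0.
Proof.
move=> anf f0 w sw.
have [->|w0] := eqVneq w 0; first by apply: f0; rewrite modc0.
have mw : 0 < modc w by rewrite modc_gt0.
pose S := [set t : R | 0 <= t <= 1 /\ forall s, 0 <= s <= t -> f (s%:C * w) = 0].
have S0 : S 0.
  split=> [|s]; first by rewrite lexx ler01.
  by move=> /le_anti <-; apply: f0; rewrite mul0r modc0.
have ubS : ubound S 1 by move=> t [] /andP[].
have supS : has_sup S by split; [exists 0|exists 1].
pose t0 := sup S.
have t01 : 0 <= t0 <= 1.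
  by rewrite ub_le_sup//=; [apply: ge_sup => //; exists 0|exists 1].
have lt_t0 s : 0 <= s < t0 -> f (s%:C * w) = 0.
  move=> /andP[s0 st0].
  have ts : 0 < t0 - s by rewrite subr_gt0.
  have [t [_ St] st] := sup_adherent ts supS.
  by apply: St; rewrite s0/= ltW//; move: st; rewrite -/t0 subKr.
have dist s : modc (s%:C * w - t0%:C * w) = `|s - t0| * modc w.
  by rewrite -mulrBl -rmorphB modcM modc_real.
(* Vanishing on the unit disc gives t0 > 0, which leaves room below t0 for zeros that accumulate at
   t0 w. *)
have t0_gt0 : 0 < t0.
  pose t1 := Num.min 1 ((modc w)^-1 / 2).
  have t1_gt0 : 0 < t1 by rewrite lt_min ltr01 divr_gt0// invr_gt0.
  apply: (lt_le_trans t1_gt0); apply: ub_le_sup; first by exists 1.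
  split; first by rewrite ltW//= ge_min lexx.
  move=> s /andP[s0 st]; apply: f0; rewrite modcM modc_real ger0_norm//.
  rewrite -ltr_pdivlMr// div1r (le_lt_trans st)// gt_min; apply/orP; right.
  by rewrite ltr_pdivrMr// ltr_pMr ?invr_gt0//; lra.
have acc e : 0 < e ->
    exists w', [/\ w' != t0%:C * w, modc (w' - t0%:C * w) < e & f w' = 0].
  move=> e0; pose d := Num.min (t0 / 2) (e / modc w / 2).
  have d0 : 0 < d by rewrite lt_min !divr_gt0.
  have dt0 : d <= t0 / 2 by rewrite ge_min lexx.
  have de : d <= e / modc w / 2 by rewrite ge_min lexx orbT.
  have dE : `|t0 - d - t0| = d by rewrite addrAC subrr sub0r normrN gtr0_norm.
  exists ((t0 - d)%:C * w); split.
  - by rewrite -subr_eq0 -modc_eq0 dist dE mulf_neq0 ?gt_eqF.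
  - rewrite dist dE -ltr_pdivlMr// (le_lt_trans de)//.
    by have : 0 < e / modc w by [rewrite divr_gt0|]; lra.
  - by apply: lt_t0; lra.
have [e e0 he] := analytic_at_zero (anf _ (slit_plane_scale t01 sw)) acc.
pose d := e / modc w / 2.
have d0 : 0 < d by rewrite !divr_gt0.
have le_t0d s : 0 <= s <= t0 + d -> f (s%:C * w) = 0.
  move=> /andP[s0 s1]; have [st|ts] := ltP s t0; first by apply: lt_t0; rewrite s0.
  apply: he; rewrite dist -ltr_pdivlMr// ger0_norm ?subr_ge0//.
  by move: s1 d0; rewrite /d; lra.
have t0E : t0 = 1.
  apply/eqP; rewrite eq_le; case/andP: (t01) => _ -> /=; rewrite leNgt; apply/negP => t0lt.
  pose t := Num.min 1 (t0 + d).
  have tt0 : t0 < t by rewrite lt_min t0lt ltrDl.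
  suff : S t by move=> /(ub_le_sup (ex_intro _ 1 ubS)); rewrite leNgt tt0.
  split; first by rewrite ge_min lexx (le_trans (ltW t0_gt0))// ltW.
  move=> s /andP[s0 st]; apply: le_t0d; rewrite s0 (le_trans st)//.
  by rewrite ge_min lexx orbT.
by rewrite -[w]mul1r; apply: (le_t0d 1); rewrite t0E; lra.
Qed.

End IdentityTheorem.

(** * Expectation of products of independent random variables *)

Section WeightedLaws.
Import HBNNSimple.
Local Open Scope ereal_scope.
Context d d3 (T1 : measurableType d) (T : measurableType d3) (R : realType).
Variables (mu : {measure set T1 -> \bar R}) (X : T1 -> T) (h : T1 -> R).
Hypotheses (mX : measurable_fun setT X) (mh : measurable_fun setT h).
Hypothesis (h_ge0 : forall t, (0 <= h t)%R).

(** A simple function is a combination of indicators of its fibres, so an identity known for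
    indicators passes to it; [weighted_integral_approx] then reaches nonnegative functions by
    monotone convergence. *)
Lemma weighted_integral_nnsfun (f : {nnsfun T >-> R}) :
  \int[mu]_t (f (X t) * h t)%:E =
  \sum_(i < #|`fset_set (range f)|) (((fset_set (range f))`_i)%R)%:E *
    \int[mu]_t (\1_(f @^-1` [set ((fset_set (range f))`_i)%R]) (X t) * h t)%:E.
Proof.
set s := fset_set (range f).
have mI i : measurable_fun setT
    (fun t => \1_(f @^-1` [set (s`_i)%R]) (X t) * h t)%R.
  apply: measurable_funM => //; apply: (measurableT_comp _ mX).
  exact: measurable_indic.
have s0 i : (i < #|`s|)%N -> (0 <= (s`_i)%R)%R.
  move=> si; have : (s`_i)%R \in s by exact: mem_nth.
  by rewrite in_fset_set// => /set_mem[x _ <-].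
transitivity (\int[mu]_t (\sum_(i < #|`s|)
    ((s`_i)%R)%:E * (\1_(f @^-1` [set (s`_i)%R]) (X t) * h t)%:E)).
  apply: eq_integral => t _.
  rewrite [in LHS]fimfunEord mulr_suml -sumEFin; apply: eq_bigr => i _.
  by rewrite -EFinM mulrA.
rewrite ge0_integral_sum//; last 2 first.
- move=> i; apply: emeasurable_funM; first exact: measurable_cst.
  exact/measurable_EFinP/mI.
- by move=> i t _; rewrite -EFinM lee_fin mulr_ge0 ?s0// mulr_ge0.
apply: eq_bigr => i _; rewrite ge0_integralZl_EFin//.
- by move=> t _; rewrite lee_fin mulr_ge0.
- exact/measurable_EFinP/mI.
- exact: s0.
Qed.

Lemma weighted_integral_approx (f : T -> \bar R) (mf : measurable_fun setT f) :
  (forall x, 0 <= f x) ->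
  \int[mu]_t (f (X t) * (h t)%:E) =
  lim (\int[mu]_t (nnsfun_approx measurableT mf n (X t) * h t)%:E
    @[n --> \oo]).
Proof.
move=> f0.
rewrite -monotone_convergence//=; last 3 first.
- move=> n; apply/measurable_EFinP; apply: measurable_funM => //.
  exact: measurableT_comp.
- by move=> n t _; rewrite lee_fin mulr_ge0.
- move=> t _ m n mn; rewrite lee_fin ler_wpM2r//.
  exact/lefP/nd_nnsfun_approx.
apply: eq_integral => t _; apply/esym/cvg_lim => //.
under eq_fun do rewrite EFinM.
by apply: cvgeZr => //; exact: cvg_nnsfun_approx.
Qed.

End WeightedLaws.

Section EqWeightedIntegral.
Import HBNNSimple.

(* Taking mu1 = mu2 and h2 constant gives independence; taking h1 = 1, mu2 the
   Lebesgue measure and X2 = id makes h2 the density of X1. *)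
Lemma eq_weighted_integral d1 d2 d (T1 : measurableType d1)
    (T2 : measurableType d2) (T : measurableType d) (R : realType)
    (mu1 : {measure set T1 -> \bar R}) (mu2 : {measure set T2 -> \bar R})
    (X1 : T1 -> T) (X2 : T2 -> T) (h1 : T1 -> R) (h2 : T2 -> R) :
  measurable_fun setT X1 -> measurable_fun setT X2 ->
  measurable_fun setT h1 -> measurable_fun setT h2 ->
  (forall t, 0 <= h1 t) -> (forall t, 0 <= h2 t) ->
  (forall A, measurable A ->
    \int[mu1]_t (\1_A (X1 t) * h1 t)%:E =
    \int[mu2]_t (\1_A (X2 t) * h2 t)%:E)%E ->
  forall f : T -> \bar R, measurable_fun setT f -> (forall x, 0 <= f x)%E ->
  (\int[mu1]_t (f (X1 t) * (h1 t)%:E) = \int[mu2]_t (f (X2 t) * (h2 t)%:E))%E.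
Proof.
move=> mX1 mX2 mh1 mh2 h10 h20 h12 f mf f0.
rewrite (weighted_integral_approx mu1 mX1 mh1 h10 mf)//.
rewrite (weighted_integral_approx mu2 mX2 mh2 h20 mf)//.
congr (lim (_ @ \oo)); apply/funext => n /=.
rewrite (weighted_integral_nnsfun mu1 mX1 mh1 h10).
rewrite (weighted_integral_nnsfun mu2 mX2 mh2 h20).
by apply: eq_bigr => i _; rewrite h12.
Qed.

End EqWeightedIntegral.

(** * Product rule for independent variables *)

Section Independence.
Context d (T : measurableType d) (R : realType) (Q : probability T R).
Variables (I : finType) (X : I -> {RV Q >-> measurableTypeR R}).
Hypothesis indep : independent Q (fun i => X i : T -> R).

(** [independent] speaks of events. These are replaced by functions one index at a time: in the
    induction the indices in [s] carry [f i] and all others carry an indicator. *)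
Lemma independent_expectation_prod (f : I -> R -> R) :
  (forall i, measurable_fun setT (f i)) -> (forall i x, 0 <= f i x) ->
  (forall i, \int[Q]_t (f i (X i t))%:E < +oo)%E ->
  (\int[Q]_t (\prod_i f i (X i t))%:E = \prod_i \int[Q]_t (f i (X i t))%:E)%E.
Proof.
move=> mf f0 ffin.
have ffin_num i : (\int[Q]_t (f i (X i t))%:E)%E \is a fin_num.
  by rewrite ge0_fin_numE// integral_ge0// => t _; rewrite lee_fin.
have mX i : measurable_fun setT (X i) := measurable_funPT (X i).
have mfX i : measurable_fun setT (fun t => f i (X i t)).
  exact: (measurableT_comp (mf i) (mX i)).
suff H (s : seq I) : uniq s -> forall A : I -> set (measurableTypeR R),
    (forall i, measurable (A i)) ->
    (\int[Q]_t (\prod_i (if i \in s then f i (X i t) else \1_(A i) (X i t)))%:E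
    = \prod_i (if i \in s then \int[Q]_t (f i (X i t))%:E
               else Q (X i @^-1` A i)))%E.
  have := H (enum I) (enum_uniq _) (fun=> setT) (fun=> measurableT).
  under eq_integral do under eq_bigr do rewrite mem_enum/=.
  by under [RHS]eq_bigr do rewrite mem_enum/=.
elim: s => [_ A mA|j s IH /= /andP[js us] A mA].
  pose J : {set I} := finset.setTfor I.
  transitivity (\int[Q]_t (\1_(\bigcap_(i in [set` J]) (X i @^-1` A i)) t)%:E)%E.
    apply: eq_integral => t _; congr (_%:E).
    rewrite indicE; under eq_bigr do rewrite /= indicE.
    have [/set_mem tA|/negP tA] := boolP (t \in _).
      rewrite big1// => i _; rewrite mem_set//; by apply: tA; rewrite /= finset.in_setT.
    apply/eqP; rewrite prodf_seq_eq0; apply/negPn/negP => /hasPn h.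
    apply: tA; apply/mem_set => i _ /=.
    have := h i (mem_index_enum i); rewrite /= pnatr_eq0 eqb0 negbK.
    by move/set_mem.
  rewrite integral_indic//; last first.
    by apply: fin_bigcap_measurable => // i _; exact: (measurable_funPTI (X i)).
  rewrite setIT; transitivity (\prod_(i in J) Q (X i @^-1` A i))%E.
    exact: (indep J mA).
  by apply: eq_bigl => i; rewrite finset.in_setT.
have IHj := IH us.
pose g t : R := \prod_(i | i != j)
  (if i \in s then f i (X i t) else \1_(A i) (X i t)).
have g0 t : 0 <= g t by apply: prodr_ge0 => i _; case: ifP.
have mg : measurable_fun setT g.
  rewrite /g; under eq_fun do rewrite -big_filter.
  apply: measurable_prod => i _; case: (i \in s) => //.
  by apply: measurableT_comp => //; exact: measurable_indic.
pose c : \bar R := (\prod_(i | i != j)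
  (if i \in s then \int[Q]_t (f i (X i t))%:E else Q (X i @^-1` A i)))%E.
have cfin : c \is a fin_num.
  apply: prode_fin_num => i _; case: ifP => // _.
  by rewrite fin_num_measure//; exact: (measurable_funPTI (X i)).
have c0 : (0 <= c)%E.
  apply: prode_ge0 => i _; case: ifP => // _.
  by rewrite integral_ge0// => t _; rewrite lee_fin.
(* This is the induction hypothesis with B at index j: against events of [X j], the random weight
   [g] integrates like the constant [c]. Hence the same holds against [f j]. *)
have key B : measurable B ->
  (\int[Q]_t (\1_B (X j t) * g t)%:E = \int[Q]_t (\1_B (X j t) * fine c)%:E)%E.
  move=> mB; transitivity (Q (X j @^-1` B) * c)%E.
    have mBA i : measurable (if i == j then B else A i) by case: ifP.
    have := IHj _ mBA; rewrite [X in _ = X -> _](bigD1 j)//= (negbTE js) eqxx.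
    rewrite [X in _ = (_ * X)%E -> _](_ : _ = c); last first.
      by apply: eq_bigr => i /negbTE ->.
    move=> <-.
    apply: eq_integral => t _; congr (_%:E).
    rewrite [RHS](bigD1 j)//= (negbTE js) eqxx; congr (_ * _).
    by apply: eq_bigr => i /negbTE ->.
  under [RHS]eq_integral do rewrite EFinM fineK//.
  rewrite ge0_integralZr//; last first.
    apply/measurable_EFinP; apply: (measurableT_comp _ (mX j)).
    exact: measurable_indic.
  have mXB : measurable (X j @^-1` B) by exact: (measurable_funPTI (X j)).
  have -> : (\int[Q]_t (\1_B (X j t))%:E = \int[Q]_t (\1_(X j @^-1` B) t)%:E)%E.
    by [].
  by rewrite integral_indic// setIT.
transitivity (\int[Q]_t ((f j (X j t))%:E * (g t)%:E))%E.
  apply: eq_integral => t _; rewrite -EFinM; congr (_%:E).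
  rewrite (bigD1 j)//= inE eqxx/=; congr (_ * _).
  by apply: eq_bigr => i ij; rewrite inE (negbTE ij).
have mfj : measurable_fun setT (EFin \o f j) by apply/measurable_EFinP.
have fj0 x : (0 <= (EFin \o f j) x)%E by rewrite lee_fin.
rewrite (eq_weighted_integral (mX j) (mX j) mg (measurable_cst _) g0
  (fun _ => fine_ge0 c0) key mfj fj0)/=.
rewrite (bigD1 j)//= inE eqxx/=.
transitivity ((\int[Q]_t (f j (X j t))%:E) * c)%E; last first.
  by congr (_ * _)%E; apply: eq_bigr => i ij; rewrite inE (negbTE ij).
under eq_integral do rewrite fineK//.
rewrite ge0_integralZr//.
- exact/measurable_EFinP.
- by move=> t _; rewrite lee_fin.
Qed.
End Independence.

(** * Beta integrals *)

Section UnitInterval.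
Variable R : realType.
Local Notation mu := (@lebesgue_measure R).
Implicit Types (a b x : R) (f g G : R -> R).

(** The integrands below may blow up at 0 and 1, so integrals are truncated by this margin. The
    shift by 2 keeps it at most 1/2, so the truncated interval is never empty. *)
Definition unit_margin (n : nat) : R := n.+2%:R^-1.

Lemma unit_margin_gt0 n : 0 < unit_margin n.
Proof. by rewrite invr_gt0. Qed.

Lemma unit_margin_le n : unit_margin n <= 2^-1.
Proof. by rewrite lef_pV2 ?posrE// ler_nat. Qed.

Lemma unit_margin_cvg0 : unit_margin n @[n --> \oo] --> (0 : R).
Proof.
have := @cvg_harmonic R; rewrite -cvg_shiftS; apply: cvg_trans.
by apply: near_eq_cvg; apply: nearW.
Qed.

Lemma unit_margin_cvg0_right : unit_margin n @[n --> \oo] --> (0 : R)^'+.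
Proof.
move=> P hP.
have h : \forall n \near \oo, 0 < unit_margin n -> P (unit_margin n).
  exact: (unit_margin_cvg0 hP).
have : \forall n \near \oo, P (unit_margin n).
  by apply: filterS h => n; apply; exact: unit_margin_gt0.
exact.
Qed.

Lemma unit_margin_sub n : `[unit_margin n, 1 - unit_margin n]%classic `<=` (`]0, 1[%classic : set R).
Proof.
move=> x /=; rewrite !in_itv/= => /andP[h1 h2].
have := unit_margin_gt0 n; lra.
Qed.

Lemma bigcup_unit_margin :
  \bigcup_n `[unit_margin n, 1 - unit_margin n]%classic = `]0, 1[%classic.
Proof.
apply/seteqP; split=> [x [n _]|x /=]; first exact: unit_margin_sub.
rewrite in_itv/= => /andP[x0 x1].
have m0 : 0 < Num.min x (1 - x) by rewrite lt_min x0 subr_gt0.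
have [N _ hN] : \forall n \near \oo, unit_margin n < Num.min x (1 - x).
  by apply: (cvgr_lt (0 : R)) => //; exact: unit_margin_cvg0.
exists N => //=; have := hN _ (leqnn N).
by rewrite /= in_itv/= lt_min => /andP[h1 h2]; move: h1 h2; lra.
Qed.

Lemma cvg_integral_unit_margin f :
  measurable_fun (`]0, 1[%classic : set R) f ->
  (forall x, 0 < x < 1 -> 0 <= f x) ->
  (\int[mu]_(x in `[unit_margin n, (1 - unit_margin n)%R]) (f x)%:E
    @[n --> \oo] --> \int[mu]_(x in `]0%R, 1%R[) (f x)%:E)%E.
Proof.
move=> mf f0; rewrite -bigcup_unit_margin.
apply: ge0_nondecreasing_set_cvg_integral => //.
- move=> m n mn; rewrite subsetEset => x /=; rewrite !in_itv/= => /andP[h1 h2].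
  have : unit_margin n <= unit_margin m.
    by rewrite lef_pV2 ?posrE// ler_nat !ltnS.
  lra.
- move=> i; apply/measurable_EFinP; apply: measurable_funS mf => //.
  exact: unit_margin_sub.
- by move=> i x /unit_margin_sub/=; rewrite in_itv/= lee_fin; exact: f0.
Qed.

Lemma FTC_unit_margin G g n :
  (forall x, 0 < x < 1 -> is_derive x 1 G (g x)) ->
  (forall x, 0 < x < 1 -> {for x, continuous g}) ->
  (\int[mu]_(x in `[unit_margin n, (1 - unit_margin n)%R]) (g x)%:E =
   (G (1 - unit_margin n) - G (unit_margin n))%:E)%E.
Proof.
move=> dG cg; have u0 := unit_margin_gt0 n; have u1 := unit_margin_le n.
(* In the degenerate case n = 0 the interval is the point 1/2 and both sides vanish. *)
have [u12|u12] := ltP (unit_margin n) (1 - unit_margin n); last first.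
  have -> : 1 - unit_margin n = unit_margin n by move: u1 u12; lra.
  by rewrite subrr set_itv1 integral_set1.
have dG' x : 0 < x < 1 -> derivable G x 1 by move=> /dG [].
have cG x : 0 < x < 1 -> {for x, continuous G}.
  by move=> /dG' /derivable1_diffP /differentiable_continuous.
rewrite (@continuous_FTC2 _ g G)//.
- apply: continuous_subspace_itv => x; rewrite in_itv/= => hx; apply: cg.
  by move: hx; lra.
- split.
  + by move=> x; rewrite in_itv/= => hx; apply: dG'; move: hx; lra.
  + by apply: cvg_at_right_filter; apply: cG; lra.
  + by apply: cvg_at_left_filter; apply: cG; lra.
- move=> x; rewrite in_itv/= => hx.
  have x01 : 0 < x < 1 by lra.
  by rewrite derive1E; have [_ ->] := dG _ x01.
Qed.

(** An improper integral: only limits of the primitive along the margins enter, and nonnegativity of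
    g makes the truncated integrals increase to the full one. *)
Lemma ge0_FTC_unit G g (l0 l1 : R) :
  (forall x, 0 < x < 1 -> is_derive x 1 G (g x)) ->
  (forall x, 0 < x < 1 -> {for x, continuous g}) ->
  (forall x, 0 < x < 1 -> 0 <= g x) ->
  G (unit_margin n) @[n --> \oo] --> l0 ->
  G (1 - unit_margin n) @[n --> \oo] --> l1 ->
  (\int[mu]_(x in `]0%R, 1%R[) (g x)%:E = (l1 - l0)%:E)%E.
Proof.
move=> dG cg g0 Gl0 Gl1.
have mg : measurable_fun (`]0, 1[%classic : set R) g.
  apply: open_continuous_measurable_fun; first exact: interval_open.
  by move=> x /set_mem; rewrite /= in_itv/=; exact: cg.
have h1 := cvg_integral_unit_margin mg g0.
have h2 : ((G (1 - unit_margin n) - G (unit_margin n))%:E @[n --> \oo] -->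
    (l1 - l0)%:E)%E.
  by apply: cvg_EFin; [exact: nearW|exact: cvgB].
apply: (@cvg_unique _ _ _ _ _ _ h1); first exact: ereal_hausdorff.
rewrite (_ : (fun n => _) = (fun n => (G (1 - unit_margin n) -
  G (unit_margin n))%:E)) //.
by apply/funext => n; exact: FTC_unit_margin.
Qed.

Lemma powR_margin_cvg0 a : 0 < a ->
  unit_margin n `^ a @[n --> \oo] --> (0 : R).
Proof.
move=> a0; apply: (cvg_comp _ (fun x => x `^ a) unit_margin_cvg0_right).
exact: powR_cvg0.
Qed.

Lemma onem_margin_cvg1 : (1 - unit_margin n) @[n --> \oo] --> (1 : R).
Proof.
rewrite -[X in _ --> X]subr0.
by apply: cvgB; [exact: cvg_cst|exact: unit_margin_cvg0].
Qed.

Lemma powR_onem_margin_cvg1 a :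
  (1 - unit_margin n) `^ a @[n --> \oo] --> (1 : R).
Proof.
have : {for (1 : R), continuous (fun x => x `^ a)}.
  have [/derivable1_diffP /differentiable_continuous //] := is_derive1_powR a (@ltr01 R).
move=> /continuous_cvg /(_ onem_margin_cvg1).
by rewrite powR1.
Qed.

Lemma is_derive_onem_powR a x : x < 1 ->
  is_derive x 1 (fun y : R => (1 - y) `^ a) (- (a * (1 - x) `^ (a - 1))).
Proof.
move=> x1; have x0 : 0 < 1 - x by rewrite subr_gt0.
have d := is_derive1_powR a x0.
have d1 : is_derive x 1 (fun y : R => 1 - y) (-1).
  by rewrite -[X in is_derive _ _ _ X]sub0r; exact: is_deriveB.
have := @is_derive1_comp _ (fun y => y `^ a) (fun y : R => 1 - y) x _ _ d d1.
by rewrite mulrN1.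
Qed.

End UnitInterval.

Definition beta_kernel (R : realType) (a b x : R) : R :=
  x `^ (a - 1) * (1 - x) `^ (b - 1).

(** Euler's beta function, kept in the extended reals: finiteness is proved directly for parameters
    at most 1, and elsewhere deduced from the total mass of a law. *)
Definition beta_integral (R : realType) (a b : R) : \bar R :=
  (\int[@lebesgue_measure R]_(x in `]0%R, 1%R[) (beta_kernel a b x)%:E)%E.

Section BetaIntegral.
Variable R : realType.
Local Notation mu := (@lebesgue_measure R).
Implicit Types (a b x : R).

Lemma beta_kernel_ge0 a b x : 0 <= beta_kernel a b x.
Proof. by rewrite mulr_ge0// powR_ge0. Qed.

Lemma measurable_beta_kernel a b (D : set R) : measurable_fun D (beta_kernel a b).
Proof.
apply: measurable_funTS; apply: measurable_funM; first exact: measurable_powR.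
apply: (measurableT_comp (measurable_powR _)).
exact: measurable_funB.
Qed.

Lemma beta_integral_ge0 a b : (0 <= beta_integral a b)%E.
Proof. by apply: integral_ge0 => x _; rewrite lee_fin beta_kernel_ge0. Qed.

Lemma continuous_powR_gt0 a x : 0 < x -> {for x, continuous (fun y : R => y `^ a)}.
Proof.
by move=> /(is_derive1_powR a)[/derivable1_diffP/differentiable_continuous].
Qed.

Lemma continuous_onem_powR a x : x < 1 ->
  {for x, continuous (fun y : R => (1 - y) `^ a)}.
Proof.
by move=> /(is_derive_onem_powR a)[/derivable1_diffP/differentiable_continuous].
Qed.

Lemma continuous_beta_kernel a b x : 0 < x < 1 ->
  {for x, continuous (beta_kernel a b)}.
Proof.
move=> /andP[x0 x1]; apply: continuousM; first exact: continuous_powR_gt0.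
exact: continuous_onem_powR.
Qed.

Lemma integral_powR_unit a : 0 < a ->
  (\int[mu]_(x in `]0%R, 1%R[) (x `^ (a - 1))%:E = (a^-1)%:E)%E.
Proof.
move=> a0; rewrite -[X in (_ = X%:E)%E]subr0.
apply: (@ge0_FTC_unit _ (fun x => a^-1 * x `^ a) (fun x => x `^ (a - 1))).
- move=> x /andP[x0 _]; have := is_derive1_powR a x0.
  move=> /(is_deriveZ a^-1); rewrite /= => h.
  by apply: (is_derive_eq h); rewrite scalerA mulVf ?gt_eqF// scale1r.
- by move=> x /andP[x0 _]; exact: continuous_powR_gt0.
- by move=> x _; exact: powR_ge0.
- rewrite -[X in _ --> X](mulr0 a^-1); apply: cvgMr; exact: powR_margin_cvg0.
- rewrite -[X in _ --> X](mulr1 a^-1); apply: cvgMr; exact: powR_onem_margin_cvg1.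
Qed.

Lemma integral_onem_powR_unit b : 0 < b ->
  (\int[mu]_(x in `]0%R, 1%R[) ((1 - x) `^ (b - 1))%:E = (b^-1)%:E)%E.
Proof.
move=> b0; rewrite -[b^-1 in RHS]opprK -[X in (_ = X%:E)%E]sub0r.
apply: (@ge0_FTC_unit _ (fun x => - b^-1 * (1 - x) `^ b)
  (fun x => (1 - x) `^ (b - 1))).
- move=> x /andP[_ x1]; have := is_derive_onem_powR b x1.
  move=> /(is_deriveZ (- b^-1)); rewrite /= => h.
  by apply: (is_derive_eq h); rewrite scalerN scaleNr opprK scalerA mulVf ?gt_eqF// scale1r.
- by move=> x /andP[_ x1]; exact: continuous_onem_powR.
- by move=> x _; exact: powR_ge0.
- rewrite -[X in _ --> X](mulr1 (- b^-1)); apply: cvgMr; exact: powR_onem_margin_cvg1.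
- rewrite -[X in _ --> X](mulr0 (- b^-1)); apply: cvgMr.
  by under eq_fun do rewrite subKr; exact: powR_margin_cvg0.
Qed.

(** On each half of the interval one factor is away from its singularity and is at most 2, its
    exponent lying between -1 and 0 and its base being at least 1/2. The other factor is a one-sided
    power with integral 1/a or 1/b. *)
Lemma beta_integral_fin a b : 0 < a <= 1 -> 0 < b <= 1 ->
  (beta_integral a b < +oo)%E.
Proof.
move=> /andP[a0 a1] /andP[b0 b1].
have half (y p : R) : 0 < p <= 1 -> 2^-1 <= y -> y `^ (p - 1) <= 2.
  move=> p01 y12; have y0 : 0 < y by move: y12; lra.
  have p1 : 0 <= 1 - p by lra.
  rewrite -[p - 1]opprB powRN; apply: (@le_trans _ _ ((2^-1) `^ (1 - p))^-1).
    by rewrite lef_pV2 ?posrE ?powR_gt0// ge0_ler_powR// nnegrE ltW.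
  rewrite -powRN opprB -powR_inv1// -powRrM mulN1r opprB.
  rewrite -[leRHS]powRr1//; apply: ler_powR; lra.
have bound x : 0 < x < 1 ->
    beta_kernel a b x <= 2 * x `^ (a - 1) + 2 * (1 - x) `^ (b - 1).
  move=> x01; have [x12|x12] := leP x 2^-1.
    have h := half (1 - x) b (ltac:(lra)) (ltac:(lra)).
    have : beta_kernel a b x <= x `^ (a - 1) * 2 by rewrite ler_wpM2l ?powR_ge0.
    have := powR_ge0 (1 - x) (b - 1); lra.
  have h := half x a (ltac:(lra)) (ltac:(lra)).
  have : beta_kernel a b x <= 2 * (1 - x) `^ (b - 1) by rewrite ler_wpM2r ?powR_ge0.
  have := powR_ge0 x (a - 1); lra.
have m1 : measurable_fun (`]0, 1[%classic : set R) (fun x => x `^ (a - 1)).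
  by apply: measurable_funTS; exact: measurable_powR.
have m2 : measurable_fun (`]0, 1[%classic : set R) (fun x => (1 - x) `^ (b - 1)).
  apply: measurable_funTS; apply: (measurableT_comp (measurable_powR _)).
  exact: measurable_funB.
have m3 : measurable_fun (`]0, 1[%classic : set R) (fun x => 2 * x `^ (a - 1)).
  exact: measurable_funM.
have m4 : measurable_fun (`]0, 1[%classic : set R) (fun x => 2 * (1 - x) `^ (b - 1)).
  exact: measurable_funM.
apply: (@le_lt_trans _ _ (\int[mu]_(x in `]0%R, 1%R[)
    ((2 * x `^ (a - 1))%:E + (2 * (1 - x) `^ (b - 1))%:E))%E).
  apply: ge0_le_integral => //.
  - move=> x _; rewrite lee_fin; exact: beta_kernel_ge0.
  - apply/measurable_EFinP; exact: measurable_beta_kernel.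
  - by apply: emeasurable_funD; exact/measurable_EFinP.
rewrite ge0_integralD//; last 4 first.
- by move=> x _; rewrite lee_fin mulr_ge0// powR_ge0.
- exact/measurable_EFinP.
- by move=> x _; rewrite lee_fin mulr_ge0// powR_ge0.
- exact/measurable_EFinP.
under eq_integral do rewrite EFinM.
rewrite ge0_integralZl_EFin//; last 2 first.
- by move=> x _; rewrite lee_fin powR_ge0.
- exact/measurable_EFinP.
under [X in (_ + X)%E]eq_integral do rewrite EFinM.
rewrite ge0_integralZl_EFin//; last 2 first.
- by move=> x _; rewrite lee_fin powR_ge0.
- exact/measurable_EFinP.
by rewrite integral_powR_unit// integral_onem_powR_unit// -!EFinM -EFinD ltry.
Qed.

(** Both exponents are nonpositive, so the kernel is at least 1 on the open interval. *)
Lemma beta_integral_gt0 a b : 0 < a <= 1 -> 0 < b <= 1 ->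
  (0 < beta_integral a b)%E.
Proof.
move=> a01 b01; apply: (@lt_le_trans _ _ (\int[mu]_(x in `]0%R, 1%R[) (cst 1 x))%E).
  by rewrite integral_cst//= lebesgue_measure_itv/= lte_fin ltr01 sube0 mul1e.
have ge1 (y p : R) : 0 < p <= 1 -> 0 < y < 1 -> 1 <= y `^ (p - 1).
  move=> p01 y01; rewrite -[leLHS](powRr0 y); apply: ger_powR; lra.
apply: ge0_le_integral => //.
- apply/measurable_EFinP; exact: measurable_beta_kernel.
- move=> x; rewrite /= in_itv/= => x01; rewrite lee_fin.
  by rewrite -[leLHS]mul1r ler_pM// ge1//; lra.
Qed.

End BetaIntegral.

(** The quotient of rising factorials (a)_k / (a+b)_k, which is the k-th moment of B(a,b). *)
Definition beta_moment (R : realType) (a b : R) (k : nat) : R :=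
  \prod_(i < k) ((a + i%:R) / (a + b + i%:R)).

Section BetaMoments.
Variable R : realType.
Local Notation mu := (@lebesgue_measure R).
Implicit Types (a b x : R).

Lemma beta_kernelSl a b x : 0 < x -> beta_kernel (a + 1) b x = x * beta_kernel a b x.
Proof.
move=> x0; rewrite /beta_kernel mulrA; congr (_ * _).
rewrite addrK -{2}(powRr1 (ltW x0)) -powRD; first by rewrite [1 + (_ - 1)]addrC subrK.
by rewrite (gt_eqF x0) implybT.
Qed.

Lemma beta_kernelSr a b x : x < 1 ->
  beta_kernel a (b + 1) x = (1 - x) * beta_kernel a b x.
Proof.
move=> x1; have x0 : 0 < 1 - x by rewrite subr_gt0.
rewrite /beta_kernel mulrCA; congr (_ * _).
rewrite addrK -{2}(powRr1 (ltW x0)) -powRD; first by rewrite [1 + (_ - 1)]addrC subrK.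
by rewrite (gt_eqF x0) implybT.
Qed.

(** Integrates the identity 1 = (1 - x) + x against the kernel. *)
Lemma beta_integral_split a b :
  (beta_integral a b = beta_integral a (b + 1)%R + beta_integral (a + 1)%R b)%E.
Proof.
rewrite -ge0_integralD//; last 4 first.
- by move=> x _; rewrite lee_fin beta_kernel_ge0.
- by apply/measurable_EFinP; exact: measurable_beta_kernel.
- by move=> x _; rewrite lee_fin beta_kernel_ge0.
- by apply/measurable_EFinP; exact: measurable_beta_kernel.
apply: eq_integral => x /set_mem; rewrite /= in_itv/= => /andP[x0 x1].
by rewrite -EFinD beta_kernelSl// beta_kernelSr// -mulrDl subrK mul1r.
Qed.

Lemma beta_integral_split_fin_num a b : (beta_integral a b < +oo)%E ->
  beta_integral a (b + 1) \is a fin_num /\ beta_integral (a + 1) b \is a fin_num.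
Proof.
rewrite beta_integral_split => fin.
have ge1 := beta_integral_ge0 a (b + 1).
have ge2 := beta_integral_ge0 (a + 1) b.
by split; rewrite (ge0_fin_numE ge1, ge0_fin_numE ge2);
  apply: le_lt_trans fin; [exact: leeDl|exact: leeDr].
Qed.

Lemma is_derive_powR_onem_powR a b x : 0 < x < 1 ->
  is_derive x 1 (fun y : R => y `^ a * (1 - y) `^ b)
    (a * beta_kernel a (b + 1) x - b * beta_kernel (a + 1) b x).
Proof.
move=> /andP[x0 x1].
have h := is_deriveM (is_derive1_powR a x0) (is_derive_onem_powR b x1).
by apply: (is_derive_eq h); rewrite /beta_kernel !addrK /GRing.scale/=; ring.
Qed.

Lemma integrable_beta_kernel_margin a b n :
  mu.-integrable `[unit_margin R n, 1 - unit_margin R n] (EFin \o beta_kernel a b).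
Proof.
apply: continuous_compact_integrable; first exact: segment_compact.
apply: continuous_subspace_itv => x; rewrite in_itv/= => hx.
apply: continuous_beta_kernel; have := unit_margin_gt0 R n; move: hx; lra.
Qed.

(* Integrating the derivative of x^a (1-x)^b over [1/n, 1-1/n]. *)
Lemma beta_integral_parts a b : 0 < a -> 0 < b ->
  (beta_integral a b < +oo)%E ->
  a * fine (beta_integral a (b + 1)) = b * fine (beta_integral (a + 1) b).
Proof.
move=> a0 b0 fin.
have [fin1 fin2] := beta_integral_split_fin_num fin.
pose J a b n := (\int[mu]_(x in `[unit_margin R n, 1 - unit_margin R n])
  beta_kernel a b x)%R.
have cJ a' b' : beta_integral a' b' \is a fin_num ->
    J a' b' n @[n --> \oo] --> fine (beta_integral a' b').
  move=> finI; apply: fine_cvg; rewrite fineK//.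
  apply: (@cvg_integral_unit_margin _ (beta_kernel a' b')).
    exact: measurable_beta_kernel.
  by move=> x _; exact: beta_kernel_ge0.
pose u n := unit_margin R n.
have E n : a * J a (b + 1) n - b * J (a + 1) b n =
    (1 - u n) `^ a * u n `^ b - u n `^ a * (1 - u n) `^ b.
  apply: EFin_inj; rewrite -[X in _ = (_ * X `^ b - _)%:E](subKr 1).
  rewrite -(@FTC_unit_margin _ (fun y => y `^ a * (1 - y) `^ b) _ n
    (fun x hx => is_derive_powR_onem_powR a b hx)); last first.
    move=> x x01; apply: (@continuousB _ _ _ (fun x => a * beta_kernel a (b + 1) x)
      (fun x => b * beta_kernel (a + 1) b x)).
      by apply: continuousM; [exact: cvg_cst|exact: continuous_beta_kernel].
    by apply: continuousM; [exact: cvg_cst|exact: continuous_beta_kernel].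
  have int1 := integrable_beta_kernel_margin a (b + 1) n.
  have int2 := integrable_beta_kernel_margin (a + 1) b n.
  have finJ a' b' : (\int[mu]_(x in `[unit_margin R n, (1 - unit_margin R n)%R])
      (beta_kernel a' b' x)%:E)%E = (J a' b' n)%:E.
    apply/esym/fineK; apply: integrable_fin_num => //.
    exact: integrable_beta_kernel_margin.
  under [in RHS]eq_integral do rewrite EFinB !EFinM.
  rewrite integralB//; last 2 first.
  - exact: (integrableZl _ a int1).
  - exact: (integrableZl _ b int2).
  rewrite (integralZl _ int1)// (integralZl _ int2)//.
  by rewrite EFinB !EFinM !finJ.
have c1 : (a * J a (b + 1) n - b * J (a + 1) b n) @[n --> \oo] -->
    a * fine (beta_integral a (b + 1)) - b * fine (beta_integral (a + 1) b).
  by apply: cvgB; apply: cvgMr; exact: cJ.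
have c2 : (a * J a (b + 1) n - b * J (a + 1) b n) @[n --> \oo] -->
    (1 * 0 - 0 * 1 : R).
  under eq_fun do rewrite E.
  apply: cvgB; apply: cvgM.
  - exact: powR_onem_margin_cvg1.
  - exact: powR_margin_cvg0.
  - exact: powR_margin_cvg0.
  - exact: powR_onem_margin_cvg1.
move: c2; rewrite mulr0 mul0r subr0 => c2.
by apply/eqP; rewrite -subr_eq0; apply/eqP; exact: (cvg_unique _ c1 c2).
Qed.

(** The splitting and the integration by parts are two linear equations in the integrals at (a, b+1)
    and (a+1, b); eliminating the former gives the recursion. *)
Lemma beta_integralS a b : 0 < a -> 0 < b -> (beta_integral a b < +oo)%E ->
  (beta_integral (a + 1)%R b = (a / (a + b))%:E * beta_integral a b)%E.
Proof.
move=> a0 b0 fin.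
have parts := beta_integral_parts a0 b0 fin.
have [fin1 fin2] := beta_integral_split_fin_num fin.
rewrite [in RHS]beta_integral_split -(fineK fin1) -(fineK fin2) -EFinD -EFinM.
congr (_%:E); apply: (@mulfI _ (a + b)); first by rewrite gt_eqF// addr_gt0.
rewrite mulrA mulrCA mulfV ?gt_eqF ?addr_gt0// mulr1 mulrDr parts mulrDl.
by rewrite addrC.
Qed.

Lemma beta_integralDn a b k : 0 < a -> 0 < b -> (beta_integral a b < +oo)%E ->
  (beta_integral (a + k%:R)%R b = (beta_moment a b k)%:E * beta_integral a b)%E.
Proof.
move=> a0 b0 fin; elim: k => [|k IH].
  by rewrite /beta_moment big_ord0 mul1e addr0.
rewrite -natr1 addrA beta_integralS//; last 2 first.
- by rewrite ltr_wpDr.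
- rewrite IH; have fin_b : beta_integral a b \is a fin_num.
    by rewrite ge0_fin_numE// beta_integral_ge0.
  by rewrite -(fineK fin_b) -EFinM ltry.
by rewrite IH muleA -EFinM /beta_moment big_ord_recr/= mulrC addrAC.
Qed.

Lemma integral_expr_beta_kernel a b k : 0 < a -> 0 < b ->
  (beta_integral a b < +oo)%E ->
  (\int[mu]_(x in `]0%R, 1%R[) (x ^+ k * beta_kernel a b x)%:E =
   (beta_moment a b k)%:E * beta_integral a b)%E.
Proof.
move=> a0 b0 fin; rewrite -beta_integralDn//.
apply: eq_integral => x /set_mem; rewrite /= in_itv/= => /andP[x0 x1].
congr (_%:E); elim: k => [|k IH]; first by rewrite mul1r addr0.
by rewrite -natr1 addrA beta_kernelSl// exprS -mulrA IH.
Qed.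

End BetaMoments.

(** * Moment sequences on the unit interval *)

Section MomentPositivity.
Variable R : realType.
Local Notation mu := (@lebesgue_measure R).
Implicit Types (s : nat -> R) (a b t x : R).

(** The positivity condition of the Hausdorff moment problem, for the functional sending x^i to
    [s i]. Stated on polynomials, it can be propagated without constructing a representing
    measure. *)
Definition unit_positive s := forall n (c : nat -> R),
  (forall x, 0 <= x <= 1 -> 0 <= \sum_(i < n) c i * x ^+ i) ->
  0 <= \sum_(i < n) c i * s i.

(** The functional is evaluation at 1. *)
Lemma unit_positive1 : unit_positive (fun=> 1).
Proof.
move=> n c /(_ 1); rewrite ler01 lexx => /(_ isT).
by under eq_bigr do rewrite expr1n.
Qed.

(** Multiplying the moments imitates multiplication by an independent beta variable. For fixed x in
    ]0,1[ the polynomial y -> p(x y) is still nonnegative on [0,1], so the functional of [s] is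
    nonnegative on it; integrating in x against the beta kernel turns each x^k into a beta moment,
    up to a positive constant. *)
Lemma unit_positive_beta s a b : 0 < a <= 1 -> 0 < b <= 1 ->
  unit_positive s -> unit_positive (fun k => s k * beta_moment a b k).
Proof.
move=> a01 b01 ps n c pc.
have /andP[a0 _] := a01; have /andP[b0 _] := b01.
have fin := beta_integral_fin a01 b01.
have fin_b : beta_integral a b \is a fin_num.
  by rewrite ge0_fin_numE// beta_integral_ge0.
have gt0 : 0 < fine (beta_integral a b).
  by rewrite fine_gt0// beta_integral_gt0.
rewrite -(pmulr_lge0 _ gt0).
pose g x := (\sum_(i < n) (c i * s i) * x ^+ i) * beta_kernel a b x.
have g0 x : 0 < x < 1 -> 0 <= g x.
  move=> /andP[x0 x1]; rewrite mulr_ge0// ?beta_kernel_ge0//.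
  under eq_bigr do rewrite mulrAC.
  apply: (ps n (fun i => c i * x ^+ i)) => y /andP[y0 y1].
  under eq_bigr do rewrite -mulrA -exprMn.
  by apply: pc; rewrite mulr_ge0 ?(ltW x0)// mulr_ile1 ?(ltW x0)// (ltW x1).
have intk k : mu.-integrable (`]0, 1[%classic : set R)
    (fun x => (x ^+ k * beta_kernel a b x)%:E).
  have m k' : measurable_fun (`]0, 1[%classic : set R)
      (fun x => (x ^+ k' * beta_kernel a b x)%:E).
    apply/measurable_EFinP; apply: measurable_funM.
      exact: measurable_funX.
    exact: measurable_beta_kernel.
  apply/integrableP; split; first exact: m.
  under eq_integral.
    move=> x /set_mem; rewrite /= in_itv/= => /andP[x0 _].
    rewrite ger0_norm; first over.
    by rewrite mulr_ge0 ?beta_kernel_ge0// exprn_ge0// ltW.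
  by rewrite integral_expr_beta_kernel// -(fineK fin_b) -EFinM ltry.
suff : (0 <= \int[mu]_(x in `]0%R, 1%R[) (g x)%:E)%E.
  rewrite (_ : (\int[mu]_(x in `]0%R, 1%R[) (g x)%:E =
    (fine (beta_integral a b) * \sum_(i < n) c i * (s i * beta_moment a b i))%:E)%E).
    by rewrite lee_fin mulrC.
  transitivity (\int[mu]_(x in `]0%R, 1%R[) (\sum_(i < n)
      (c i * s i)%:E * (x ^+ i * beta_kernel a b x)%:E))%E.
    apply: eq_integral => x _; rewrite /g mulr_suml -sumEFin.
    apply: eq_bigr => i _; rewrite -EFinM; congr (_%:E); ring.
  rewrite integral_sum//; last by move=> i; exact: integrableZl.
  rewrite mulr_sumr -sumEFin; apply: eq_bigr => i _.
  rewrite integralZl// integral_expr_beta_kernel// -(fineK fin_b) -!EFinM.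
  by congr (_%:E); ring.
by apply: integral_ge0 => x; rewrite /= in_itv/= lee_fin; exact: g0.
Qed.

Lemma unit_positive_prod (I : Type) (l : seq I) (a b : I -> R) :
  (forall i, 0 < a i <= 1) -> (forall i, 0 < b i <= 1) ->
  unit_positive (fun k => \prod_(i <- l) beta_moment (a i) (b i) k).
Proof.
move=> ha hb; elim: l => [|i l IH].
  by move=> n c hc; under eq_bigr do rewrite big_nil; exact: unit_positive1.
move=> n c hc; under eq_bigr do rewrite big_cons mulrC [_ * \prod_(_ <- _) _]mulrC.
under eq_bigr do rewrite mulrC.
exact: (unit_positive_beta (ha i) (hb i) IH hc).
Qed.

(* The left-hand side is the functional applied to (2x-1)^N. *)
Lemma unit_positive_power s N : s 0 = 1 -> unit_positive s ->
  \sum_(i < N.+1) (-1) ^+ (N - i) * 2 ^+ i * 'C(N, i)%:R * s i <= 1.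
Proof.
move=> s0 ps; pose d i : R := (-1) ^+ (N - i) * 2 ^+ i * 'C(N, i)%:R.
have E (f : nat -> R) : \sum_(i < N.+1) ((i == 0%N :> nat)%:R - d i) * f i =
    f 0%N - \sum_(i < N.+1) d i * f i.
  under eq_bigr do rewrite mulrBl.
  rewrite sumrB big_ord_recl/= mul1r [X in _ + X - _]big1 ?addr0// => i _.
  by rewrite mul0r.
have := ps N.+1 (fun i => (i == 0%N)%:R - d i).
rewrite (E s) s0 subr_ge0; apply => x /andP[x0 x1].
rewrite (E (fun i => x ^+ i)) expr0.
rewrite (_ : \sum_(i < _) _ = (-1 + 2 * x) ^+ N); last first.
  rewrite exprDn; apply: eq_bigr => i _.
  by rewrite /d exprMn -[in RHS]mulr_natr; ring.
rewrite subr_ge0 (le_trans (ler_norm _))// normrX exprn_ile1// ler_norml; lra.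
Qed.

End MomentPositivity.

(** * Support of a law with positive moment functional *)

Section MomentSupport.
Variables (R : realType) (F : probability (measurableTypeR R) R).
Variables (L : R) (s : nat -> R).
Hypotheses (L0 : 0 < L) (s0 : s 0 = 1) (ps : unit_positive s).
Hypothesis F_moment : forall k, (\int[F]_x (x ^+ k)%:E = (s k * L ^+ k)%:E)%E.

Lemma measurable_exprR k : measurable_fun setT (fun x : measurableTypeR R => (x ^+ k)%:E).
Proof. by apply/measurable_EFinP; exact: measurable_funX. Qed.

(** An even power is nonnegative, so its finite integral already means integrability; any |x|^k is
    at most 1 + x^(2k). *)
Lemma integrable_moment k : F.-integrable setT (fun x => (x ^+ k)%:E).
Proof.
have even_int j : F.-integrable setT (fun x => (x ^+ j.*2)%:E).
  apply/integrableP; split; first exact: measurable_exprR.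
  under eq_integral.
    move=> x _; rewrite /= ger0_norm; first over.
    by rewrite -mul2n exprM exprn_ge0// sqr_ge0.
  by rewrite F_moment ltry.
apply: (@le_integrable _ _ _ F setT measurableT (fun x => (x ^+ k)%:E)
  (fun x => (1 + x ^+ k.*2)%:E)).
- exact: measurable_exprR.
- move=> x _ /=; rewrite !lee_fin -mul2n mulnC exprM normrX.
  rewrite [leRHS]ger0_norm ?addr_ge0 ?sqr_ge0//.
  rewrite -[_ ^+ k ^+ 2]real_normK ?num_real// normrX.
  have : 0 <= (`|x| ^+ k - 1) ^+ 2 + `|x| ^+ k by rewrite addr_ge0 ?sqr_ge0// exprn_ge0.
  by rewrite sqrrB expr1n; move: (exprn_ge0 k (normr_ge0 x)); lra.
- apply: (@integrableD _ _ _ F setT measurableT (fun=> 1%:E)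
    (fun x => (x ^+ k.*2)%:E)) => //.
  exact: finite_measure_integrable_cst.
Qed.

Lemma integral_centered_power N :
  (\int[F]_x ((-1 + 2 * (x / L)) ^+ N)%:E =
   (\sum_(i < N.+1) (-1) ^+ (N - i) * 2 ^+ i * 'C(N, i)%:R * s i)%:E)%E.
Proof.
pose d i : R := (-1) ^+ (N - i) * 2 ^+ i * 'C(N, i)%:R.
transitivity (\int[F]_x (\sum_(i < N.+1) (d i / L ^+ i)%:E * (x ^+ i)%:E))%E.
  apply: eq_integral => x _; rewrite exprDn -sumEFin; apply: eq_bigr => i _.
  rewrite -EFinM; congr (_%:E).
  by rewrite /d exprMn expr_div_n -[in LHS]mulr_natr; ring.
rewrite integral_sum//; last first.
  by move=> i; apply: integrableZl => //; exact: integrable_moment.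
rewrite -sumEFin; apply: eq_bigr => i _.
rewrite integralZl//; last exact: integrable_moment.
rewrite F_moment -EFinM; congr (_%:E); rewrite -/(d i).
by rewrite mulrACA mulVf ?mulr1// expf_neq0// gt_eqF.
Qed.

(** The affine map taking [0, L] onto [-1, 1]. *)
Let y (x : R) := -1 + 2 * (x / L).

Lemma measurable_centered : measurable_fun setT (y : measurableTypeR R -> R).
Proof.
apply: measurable_funD => //; apply: measurable_funM => //.
exact: measurable_funM.
Qed.

(** The even moments of [y] are at most 1 at every order, yet they dominate (1+e)^(2n) times the
    mass of the tail. Bernoulli's inequality 1 + n e <= (1+e)^n turns this into unbounded growth in
    n unless the mass is 0. *)
Lemma centered_tail_null (e : R) : 0 < e -> F [set x | 1 + e <= `|y x|] = 0%E.
Proof.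
move=> e0; set A := [set x | _].
have mA : measurable A.
  rewrite -[A]setTI (_ : A = (fun x => `|y x|) @^-1` `[1 + e, +oo[%classic).
    exact: (measurableT_comp (@normr_measurable R setT) measurable_centered).
  by apply/seteqP; split => x /=; rewrite in_itv/= andbT.
have le1 n : ((1 + n%:R * e)%:E * F A <= 1)%E.
  have bern : 1 + n%:R * e <= (1 + e) ^+ n.*2.
    apply: (@le_trans _ _ ((1 + e) ^+ n)); last first.
      by apply: ler_weXn2l; [rewrite lerDl ltW|rewrite -addnn leq_addr].
    elim: n => [|n IH]; first by rewrite mul0r addr0.
    rewrite exprS -natr1 mulrDl mul1r.
    have h : (1 + e) * (1 + n%:R * e) <= (1 + e) * (1 + e) ^+ n.
      by rewrite ler_wpM2l// addr_ge0// ltW.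
    apply: le_trans h; have : 0 <= n%:R * e * e by rewrite !mulr_ge0// ltW.
    lra.
  apply: (@le_trans _ _ (((1 + e) ^+ n.*2)%:E * F A)%E).
    by rewrite lee_wpmul2r// lee_fin.
  rewrite -(setIT A) -integral_cst//.
  apply: (@le_trans _ _ (\int[F]_x ((y x) ^+ n.*2)%:E)%E); last first.
    rewrite integral_centered_power lee_fin.
    exact: unit_positive_power.
  have even_ge0 x : 0 <= y x ^+ n.*2.
    by rewrite -mul2n exprM exprn_ge0// sqr_ge0.
  apply: (@le_trans _ _ (\int[F]_(x in A) ((y x) ^+ n.*2)%:E)%E).
    rewrite setIT; apply: ge0_le_integral => //.
    - by move=> x _; rewrite lee_fin exprn_ge0// addr_ge0// ltW.
    - apply/measurable_EFinP; apply: measurable_funTS; apply: measurable_funX.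
      exact: measurable_centered.
    - move=> x Ax; rewrite lee_fin -(ger0_norm (even_ge0 x)) normrX.
      by apply: lerXn2r => //; rewrite nnegrE// addr_ge0// ltW.
  apply: ge0_subset_integral => //.
    apply/measurable_EFinP; apply: measurable_funX; exact: measurable_centered.
  by move=> x _; rewrite lee_fin.
by rewrite setIT.
apply: le_anti; rewrite measure_ge0 andbT leNgt; apply/negP => FA0.
have fin : F A \is a fin_num by rewrite fin_num_measure.
rewrite -(fineK fin) lte_fin in FA0.
have [n hn] : exists n : nat, (fine (F A))^-1 / e <= n%:R.
  exists (Num.truncn ((fine (F A))^-1 / e)).+1; exact/ltW/truncnS_gt.
have := le1 n; rewrite -(fineK fin) -EFinM lee_fin leNgt => /negP; apply.
rewrite ler_pdivrMr// in hn; have : 1 <= n%:R * e * fine (F A).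
  by rewrite -ler_pdivrMr// div1r.
by rewrite mulrDl mul1r; move: FA0; lra.
Qed.

Lemma moment_support : F (~` `[0, L]%classic) = 0%E.
Proof.
have sub : ~` `[0, L]%classic `<=`
    \bigcup_n [set x | 1 + n.+1%:R^-1 <= `|y x|].
  move=> x /=; rewrite in_itv/= => /negP; rewrite negb_and -!ltNge => x01.
  have yx : 1 < `|y x|.
    rewrite ltr_normr; case/orP: x01 => h.
      have : x / L < 0 by rewrite pmulr_llt0 ?invr_gt0.
      by rewrite /y => ?; apply/orP; right; lra.
    have : 1 < x / L by rewrite ltr_pdivlMr// mul1r.
    by rewrite /y => ?; apply/orP; left; lra.
  have [N _ hN] : \forall n \near \oo, n.+1%:R^-1 < `|y x| - 1.
    by apply: (cvgr_lt (0 : R)); [exact: cvg_harmonic|rewrite subr_gt0].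
  exists N => //=; rewrite -lerBrDl; exact/ltW/(hN _ (leqnn N)).
have mA n : measurable [set x | 1 + n.+1%:R^-1 <= `|y x|].
  rewrite -[X in measurable X]setTI
    (_ : [set x | _] = (fun x => `|y x|) @^-1` `[1 + n.+1%:R^-1, +oo[%classic).
    exact: (measurableT_comp (@normr_measurable R setT) measurable_centered).
  by apply/seteqP; split => x /=; rewrite in_itv/= andbT.
apply: measure_negligible; first exact: measurableC.
apply: (@negligibleS _ _ _ F _ (~` `[0, L]%classic) sub).
apply: negligible_bigcup => n.
exists [set x | 1 + n.+1%:R^-1 <= `|y x|]; split; first exact: mA.
  by apply: centered_tail_null; rewrite invr_gt0.
exact: subset_refl.
Qed.

End MomentSupport.

(** * Moment determinacy on a bounded interval *)

Section SupportedIntegral.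
Variables (R : realType) (F : probability (measurableTypeR R) R) (L : R).
Hypothesis suppF : F (~` `[0, L]%classic) = 0%E.
Implicit Types (h : measurableTypeR R -> R).

Lemma integral_supported_le h M : measurable_fun setT h ->
  (forall x, 0 <= x <= L -> `|h x| <= M) ->
  (\int[F]_x `|(h x)%:E| <= M%:E)%E.
Proof.
move=> mh hM.
(* A negative bound would force [0, L] to be empty, and F would give mass 0 to the whole line. *)
have [M0|M0] := leP 0 M; last first.
  suff : F [set: measurableTypeR R] = 0%E.
    by rewrite probability_setT => /eqP; rewrite gt_eqF.
  rewrite -suppF; congr (F _); apply/seteqP; split=> // x _ /=.
  by rewrite in_itv/= => /hM; rewrite leNgt (lt_le_trans M0).
apply: (@le_trans _ _ (\int[F]_x (cst M%:E x))%E); last first.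
  have -> : (\int[F]_x (cst M%:E x) = M%:E * F setT)%E by exact: integral_cst.
  by have -> : (F setT = 1)%E; [exact: probability_setT|rewrite mule1].
apply: ae_ge0_le_integral => //.
- by apply: measurableT_comp => //; exact/measurable_EFinP.
- exists (~` `[0, L]%classic); split => //; first exact: measurableC.
  move=> x /= hx; rewrite in_itv/= => x01; apply: hx => _.
  by rewrite lee_fin hM.
Qed.

Lemma integrable_supported h M : measurable_fun setT h ->
  (forall x, 0 <= x <= L -> `|h x| <= M) ->
  F.-integrable setT (EFin \o h).
Proof.
move=> mh hM; apply/integrableP; split; first exact/measurable_EFinP.
exact: le_lt_trans (integral_supported_le mh hM) (ltry _).
Qed.

Lemma Rintegral_supported_le h M : measurable_fun setT h ->
  (forall x, 0 <= x <= L -> `|h x| <= M) ->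
  `|\int[F]_x h x| <= M.
Proof.
move=> mh hM; rewrite -lee_fin EFin_normr_Rintegral//; last first.
  exact: integrable_supported hM.
apply: le_trans (integral_supported_le mh hM).
by apply: le_abse_integral => //; exact/measurable_EFinP.
Qed.

End SupportedIntegral.

(** * Bernstein approximation and ramp functions *)

Section Bernstein.
Variable R : realType.
Implicit Types (x : R) (f : R -> R).

Definition bernstein n k x : R := 'C(n, k)%:R * x ^+ k * (1 - x) ^+ (n - k).

Lemma bernstein_ge0 n k x : 0 <= x <= 1 -> 0 <= bernstein n k x.
Proof.
by move=> /andP[x0 x1]; rewrite !mulr_ge0// exprn_ge0// subr_ge0.
Qed.

Lemma sum_bernstein n x : \sum_(k < n.+1) bernstein n k x = 1.
Proof.
rewrite -[RHS](expr1n _ n) -[1 in RHS](subrK x) exprDn.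
by apply: eq_bigr => k _; rewrite -mulr_natl /bernstein; ring.
Qed.

(** The absorption identity for binomial coefficients; it produces the first two moments of the
    binomial law. *)
Lemma bernsteinS n k x :
  k.+1%:R * bernstein n.+1 k.+1 x = n.+1%:R * x * bernstein n k x.
Proof.
by rewrite /bernstein subSS exprS !mulrA -!natrM -mul_bin_diag; ring.
Qed.

Lemma sum_bernstein1 n x :
  \sum_(k < n.+1) k%:R * bernstein n k x = n%:R * x.
Proof.
case: n => [|n]; first by rewrite big_ord_recl big_ord0 !mul0r addr0.
rewrite big_ord_recl mul0r add0r.
under eq_bigr do rewrite lift0 bernsteinS.
by rewrite -mulr_sumr sum_bernstein mulr1.
Qed.

Lemma sum_bernstein2 n x :
  \sum_(k < n.+1) k%:R ^+ 2 * bernstein n k x =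
  n%:R * x * (1 + n.-1%:R * x).
Proof.
case: n => [|n]; first by rewrite big_ord_recl big_ord0 expr0n !mul0r addr0.
rewrite big_ord_recl expr0n mul0r add0r.
have E k : k.+1%:R ^+ 2 * bernstein n.+1 k.+1 x =
    n.+1%:R * x * (k%:R * bernstein n k x + bernstein n k x).
  by rewrite expr2 -mulrA bernsteinS -[k.+1%:R]natr1; ring.
under eq_bigr do rewrite lift0 E.
by rewrite -mulr_sumr big_split/= sum_bernstein1 sum_bernstein addrC.
Qed.

(** The sum is the variance x (1 - x) / n of a binomial frequency. *)
Lemma bernstein_variance n x : (0 < n)%N -> 0 <= x <= 1 ->
  \sum_(k < n.+1) (k%:R / n%:R - x) ^+ 2 * bernstein n k x <= n%:R^-1.
Proof.
move=> n0 /andP[x0 x1].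
have n_neq0 : n%:R != 0 :> R by rewrite pnatr_eq0 -lt0n.
have n_gt0 : 0 < n%:R :> R by rewrite ltr0n.
have E (k : nat) : (k%:R / n%:R - x) ^+ 2 * bernstein n k x =
    n%:R^-1 ^+ 2 * (k%:R ^+ 2 * bernstein n k x) +
    (- (2 * x / n%:R) * (k%:R * bernstein n k x) + x ^+ 2 * bernstein n k x).
  by ring.
under eq_bigr do rewrite E.
rewrite big_split/= big_split/= -!mulr_sumr sum_bernstein2 sum_bernstein1.
rewrite sum_bernstein mulr1.
have -> : n.-1%:R = n%:R - 1 :> R by rewrite -subn1 natrB.
have -> : n%:R^-1 ^+ 2 * (n%:R * x * (1 + (n%:R - 1) * x)) +
    (- (2 * x / n%:R) * (n%:R * x) + x ^+ 2) = n%:R^-1 * (x * (1 - x)).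
  by field.
rewrite ler_piMr ?invr_ge0 ?ler0n//; nra.
Qed.

Definition bernstein_poly f n x : R :=
  \sum_(k < n.+1) f (k%:R / n%:R) * bernstein n k x.

(** The inequality |u| <= e + u^2 / e reduces the mean deviation of the binomial frequency from x to
    its variance, with no case split between near and far nodes. *)
Lemma bernstein_lipschitz f (K : R) n x e : 0 <= K ->
  (forall u v, `|f u - f v| <= K * `|u - v|) -> 0 <= x <= 1 -> (0 < n)%N ->
  0 < e -> `|f x - bernstein_poly f n x| <= K * (e + e^-1 / n%:R).
Proof.
move=> K0 lf x01 n0 e0.
have dist u : `|u| <= e + e^-1 * u ^+ 2.
  rewrite -(@ler_pM2l _ e)// mulrDr mulrA mulfV ?gt_eqF// mul1r.
  rewrite -[u ^+ 2]real_normK ?num_real//.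
  by have := normr_ge0 u; nra.
rewrite -[f x]mulr1 -(sum_bernstein n x) mulr_sumr -sumrB.
apply: le_trans (ler_norm_sum _ _ _) _.
apply: (@le_trans _ _ (\sum_(k < n.+1)
    (K * e * bernstein n k x +
     K * e^-1 * ((k%:R / n%:R - x) ^+ 2 * bernstein n k x)))).
  apply: ler_sum => k _; rewrite -mulrBl normrM.
  rewrite (ger0_norm (bernstein_ge0 _ _ x01)).
  rewrite [leRHS](_ : _ = K * (e + e^-1 * (k%:R / n%:R - x) ^+ 2) *
    bernstein n k x); last by ring.
  rewrite ler_wpM2r ?bernstein_ge0//; apply: (le_trans (lf _ _)).
  by rewrite distrC ler_wpM2l.
rewrite big_split/= -!mulr_sumr sum_bernstein mulr1 mulrDr lerD2l.
rewrite -mulrA ler_wpM2l// ler_wpM2l ?invr_ge0 ?(ltW e0)//.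
exact: bernstein_variance.
Qed.

Lemma bernstein_poly_horner f n (L : R) :
  exists p : {poly R}, forall x, p.[x] = bernstein_poly f n (x / L).
Proof.
exists (\sum_(k < n.+1) (f (k%:R / n%:R))%:P * ('C(n, k)%:R%:P *
  ('X * L^-1%:P) ^+ k * (1 - 'X * L^-1%:P) ^+ (n - k))).
by move=> x; rewrite horner_sum; apply: eq_bigr => k _; rewrite !hornerE.
Qed.

(** For m > 0 it equals 1 up to t, 0 from t + 1/m on, and has slope -m in between: a Lipschitz
    majorant of the indicator of the ray up to t. *)
Definition ramp (t : R) (m : nat) x : R :=
  Num.min 1 (Num.max 0 (1 + m%:R * (t - x))).

Lemma ramp_lipschitz t m u v :
  `|ramp t m u - ramp t m v| <= m%:R * `|u - v|.
Proof.
have m0 : 0 <= m%:R :> R by [].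
rewrite /ramp -[m%:R in leRHS]ger0_norm// -normrM.
have -> : m%:R * (u - v) = (1 + m%:R * (t - v)) - (1 + m%:R * (t - u)) by ring.
set a := 1 + _; set b := 1 + _.
rewrite ler_norml; have := ler_norm (b - a); have := ler_norm (a - b).
rewrite (distrC a b).
have E10 : Num.min 1 0 = 0 :> R by rewrite min_r.
have [a0|a0] := leP 0 a; have [b0|b0] := leP 0 b; rewrite ?E10;
  have [a1|a1] := leP 1 a; have [b1|b1] := leP 1 b; lra.
Qed.

Lemma ramp_ge0 t m x : 0 <= ramp t m x.
Proof. by rewrite le_min ler01 le_max lexx. Qed.

Lemma ramp_le1 t m x : ramp t m x <= 1.
Proof. by rewrite ge_min lexx. Qed.

Lemma measurable_ramp t m : measurable_fun setT (ramp t m).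
Proof.
apply: measurable_minr => //; apply: measurable_maxr => //.
apply: measurable_funD => //; apply: measurable_funM => //.
exact: measurable_funB.
Qed.

Lemma ramp_cvg t x : ramp t m x @[m --> \oo] --> (\1_(`]-oo, t]%classic) x : R).
Proof.
rewrite indicE; have [xt|tx] := leP x t.
  rewrite mem_set/=; last by rewrite in_itv.
  apply: cvg_near_cst; apply: nearW => m; rewrite /ramp.
  rewrite max_r ?min_l// ?lerDl ?addr_ge0// mulr_ge0// subr_ge0//.
rewrite memNset/=; last by rewrite in_itv/= leNgt tx.
apply: cvg_near_cst; exists (Num.truncn (x - t)^-1).+1 => // m /= hm.
rewrite /ramp max_l ?min_r//.
have xt : 0 < x - t by rewrite subr_gt0.
have : (x - t)^-1 <= m%:R.
  by rewrite (le_trans (ltW (truncnS_gt _)))// ler_nat.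
by rewrite -div1r ler_pdivrMr//; lra.
Qed.

End Bernstein.

(** * Laws on a bounded interval with equal moments *)

Section MomentDeterminacy.
Variables (R : realType) (F G : probability (measurableTypeR R) R) (L : R).
Hypotheses (L0 : 0 < L) (suppF : F (~` `[0, L]%classic) = 0%E)
  (suppG : G (~` `[0, L]%classic) = 0%E).
Hypothesis eq_moments : forall k,
  (\int[F]_x (x ^+ k)%:E = \int[G]_x (x ^+ k)%:E)%E.

Lemma horner_supported (H : probability (measurableTypeR R) R) (p : {poly R}) :
  H (~` `[0, L]%classic) = 0%E ->
  (\int[H]_x (p.[x])%:E = \sum_(i < size p) (p`_i)%:E * \int[H]_x (x ^+ i)%:E)%E.
Proof.
move=> suppH.
have int_pow k : H.-integrable setT (fun x => (x ^+ k)%:E).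
  apply: (integrable_supported suppH (h := fun x => x ^+ k) (M := L ^+ k)).
    exact: measurable_funX.
  move=> x /andP[x0 xL]; rewrite ger0_norm ?exprn_ge0//.
  by apply: lerXn2r => //; rewrite nnegrE// ltW.
under eq_integral do rewrite horner_coef -sumEFin.
rewrite integral_sum//.
  by apply: eq_bigr => i _; rewrite -integralZl.
by move=> i; exact: (integrableZl measurableT (p`_i) (int_pow i)).
Qed.

Lemma eq_integral_ramp t m :
  (\int[F]_x ramp (t / L) m (x / L) = \int[G]_x ramp (t / L) m (x / L))%R.
Proof.
pose f (x : R) := ramp (t / L) m x.
have mfL : measurable_fun setT (fun x : measurableTypeR R => f (x / L)).
  apply: (measurableT_comp (measurable_ramp _ _)).
  exact: measurable_funM.
have f1 x : `|f x| <= 1 by rewrite ger0_norm ?ramp_ge0// ramp_le1.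
have L01 x : 0 <= x <= L -> 0 <= x / L <= 1.
  by move=> /andP[x0 xL]; rewrite divr_ge0 ?(ltW L0)//= ler_pdivrMr// mul1r.
have key (e : R) : 0 < e -> `|\int[F]_x f (x / L) - \int[G]_x f (x / L)|%R <= e.
  (* With n at least e1^-2 the Bernstein error is at most (m + 1)(e1 + e1) = e/2, once for each law.
     Using m + 1 covers m = 0. *)
  move=> e0; pose e1 := e / (4 * (m%:R + 1)).
  have m0 : 0 <= m%:R :> R by [].
  have e10 : 0 < e1 by rewrite divr_gt0// mulr_gt0//; lra.
  pose n := (Num.truncn (e1^-1 / e1)).+1.
  have n0 : (0 < n%:R :> R) by rewrite ltr0n.
  have hn : e1^-1 / n%:R <= e1.
    rewrite ler_pdivrMr// mulrC -ler_pdivrMr//.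
    exact/ltW/truncnS_gt.
  have [p hp] := bernstein_poly_horner f n L.
  have mp : measurable_fun setT (fun x : measurableTypeR R => p.[x]).
    under eq_fun do rewrite horner_coef.
    apply: measurable_sum => i.
    apply: measurable_funM; first exact: measurable_cst.
    exact: measurable_funX.
  have close x : 0 <= x <= L -> `|f (x / L) - p.[x]| <= e / 2.
    move=> x01; rewrite hp.
    apply: (le_trans (bernstein_lipschitz (n := n) (e := e1) m0
      (@ramp_lipschitz _ _ _) (L01 _ x01) _ e10)) => //.
    apply: (@le_trans _ _ ((m%:R + 1) * (e1 + e1))).
      apply: ler_pM => //; [|lra..].
      by rewrite addr_ge0 ?(ltW e10)// divr_ge0 ?invr_ge0// ltW.
    by rewrite le_eqVlt; apply/orP; left; apply/eqP; rewrite /e1; field; lra.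
  have approx (H : probability (measurableTypeR R) R) :
      H (~` `[0, L]%classic) = 0%E ->
      `|\int[H]_x f (x / L) - \int[H]_x p.[x]|%R <= e / 2.
    move=> suppH.
    have intf : H.-integrable setT (EFin \o (fun x => f (x / L))).
      by apply: (integrable_supported suppH mfL (M := 1)).
    have intp : H.-integrable setT (EFin \o (fun x => p.[x])).
      apply: (integrable_supported suppH mp (M := 1 + e / 2)) => x x01.
      have := close _ x01; have := f1 (x / L); rewrite !ler_norml; lra.
    rewrite -RintegralB//.
    apply: (Rintegral_supported_le suppH) => //.
    exact: measurable_funB.
  have pp : (\int[F]_x p.[x] = \int[G]_x p.[x])%R.
    rewrite /Rintegral !horner_supported//.
    by congr fine; apply: eq_bigr => i _; rewrite eq_moments.
  have := approx F suppF; have := approx G suppG; rewrite pp !ler_norml.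
  lra.
apply/eqP; rewrite -subr_eq0 -normr_le0; apply/ler_addgt0Pl => e e0.
by rewrite addr0; exact: key.
Qed.

Lemma cvg_integral_ramp (H : probability (measurableTypeR R) R) t :
  (\int[H]_x ramp (t / L) m (x / L) @[m --> \oo] --> fine (H `]-oo, t]%classic))%R.
Proof.
have mr m : measurable_fun setT (fun x : measurableTypeR R => ramp (t / L) m (x / L)).
  apply: (measurableT_comp (measurable_ramp _ _)).
  exact: measurable_funM.
pose f_ m (x : measurableTypeR R) := (ramp (t / L) m (x / L))%:E.
pose g (x : measurableTypeR R) := (\1_(`]-oo, t]%classic) x : R)%:E.
have mf_ m : measurable_fun setT (f_ m) by apply/measurable_EFinP.
have mg : measurable_fun setT g.
  by apply/measurable_EFinP; exact: measurable_indic.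
have fg : {ae H, forall x, setT x -> f_ ^~ x @ \oo --> g x}.
  apply: aeW => x _; apply: cvg_EFin; first exact: nearW.
  have -> : \1_(`]-oo, t]%classic) x = \1_(`]-oo, t / L]%classic) (x / L) :> R.
    rewrite !indicE; congr (nat_of_bool _)%:R.
    by apply/idP/idP => /set_mem h; apply/mem_set; move: h;
      rewrite /= !in_itv/= ler_pM2r ?invr_gt0.
  exact: ramp_cvg.
have i1 : H.-integrable setT (EFin \o cst (1 : R)).
  exact: finite_measure_integrable_cst.
have f1 : {ae H, forall x n, setT x -> (`|f_ n x| <= (EFin \o cst 1%R) x)%E}.
  apply: aeW => x m _; rewrite lee_fin ger0_norm ?ramp_ge0//.
  exact: ramp_le1.
have [_ _] := dominated_convergence measurableT mf_ mg fg i1 f1.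
rewrite /g integral_indic// setIT => h.
by apply: fine_cvg; rewrite fineK ?fin_num_measure.
Qed.

(** The distribution functions agree as limits of integrals of ramps, and the open upper rays form
    an intersection-stable family generating the Borel sets. *)
Lemma moment_determinacy : eq_law F G.
Proof.
have ray t : F `]-oo, t]%classic = G `]-oo, t]%classic.
  rewrite -(fineK (fin_num_measure F _ (measurable_itv _))).
  rewrite -(fineK (fin_num_measure G _ (measurable_itv _))).
  have cF := @cvg_integral_ramp F t; have := @cvg_integral_ramp G t.
  under eq_fun do rewrite -eq_integral_ramp.
  by move=> /(cvg_unique (@Rhausdorff R) cF) ->.
move=> A mA.
have mE : @measurable _ (measurableTypeR R) = <<s @RGenOInfty.G R >>.
  exact: RGenOInfty.measurableE.
apply: (@measure_unique _ R (measurableTypeR R) (@RGenOInfty.G R)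
  (fun n => `]- n%:R, +oo[%classic) mE _ _ _ F G) => //.
- move=> _ _ [x ->] [y ->]; exists (Num.max x y).
  by apply/seteqP; split=> z /=; rewrite !in_itv/= !andbT gt_max;
    [move=> [-> ->]|move=> /andP[]].
- by move=> i; eexists; reflexivity.
- apply/seteqP; split=> // x _; exists (Num.truncn `|x|).+1 => //=.
  rewrite in_itv/= andbT ltrNl.
  by rewrite (le_lt_trans _ (truncnS_gt _))// -normrN ler_norm.
- move=> _ [x ->]; have -> : `]x, +oo[%classic = ~` `]-oo, x]%classic :> set R.
    by rewrite setCitvl.
  have mx : measurable (`]-oo, x]%classic : set (measurableTypeR R)) by [].
  transitivity (1 - F `]-oo, x]%classic)%E; first exact: probability_setC mx.
  by rewrite ray; apply/esym; exact: probability_setC mx.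
- by move=> k; rewrite (le_lt_trans (probability_le1 _ _))// ltry.
Qed.

End MomentDeterminacy.

(** * Complex-valued integrals *)

Definition cmeasurable d (T : measurableType d) (R : realType)
    (f : T -> R[i]) : Prop :=
  measurable_fun setT (fun t => complex.Re (f t)) /\
  measurable_fun setT (fun t => complex.Im (f t)).

Section ComplexMeasurable.
Context d (T : measurableType d) (R : realType).
Implicit Types (f g : T -> R[i]) (c z : R[i]).

Lemma Re_mulc z c : complex.Re (z * c) =
  complex.Re z * complex.Re c - complex.Im z * complex.Im c.
Proof. by case: z; case: c. Qed.

Lemma Im_mulc z c : complex.Im (z * c) =
  complex.Re z * complex.Im c + complex.Im z * complex.Re c.
Proof. by case: z; case: c. Qed.

Lemma Re_addc z c : complex.Re (z + c) = complex.Re z + complex.Re c.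
Proof. by case: z; case: c. Qed.

Lemma Im_addc z c : complex.Im (z + c) = complex.Im z + complex.Im c.
Proof. by case: z; case: c. Qed.

(** The real power form reduces measurability of an inverse to that of [powR]; both sides are 0 at z
    = 0. *)
Lemma Re_invc z : complex.Re z^-1 =
  complex.Re z * (complex.Re z ^+ 2 + complex.Im z ^+ 2) `^ (-1).
Proof. by rewrite powR_inv1 ?addr_ge0 ?sqr_ge0//; case: z. Qed.

Lemma Im_invc z : complex.Im z^-1 =
  - (complex.Im z * (complex.Re z ^+ 2 + complex.Im z ^+ 2) `^ (-1)).
Proof. by rewrite powR_inv1 ?addr_ge0 ?sqr_ge0//; case: z. Qed.

Lemma cmeasurable_cst c : cmeasurable (fun _ : T => c).
Proof. by split; exact: measurable_cst. Qed.

Lemma cmeasurable_real (h : T -> R) : measurable_fun setT h ->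
  cmeasurable (fun t => (h t)%:C).
Proof. by move=> mh; split => //; exact: measurable_cst. Qed.

Lemma cmeasurableD f g : cmeasurable f -> cmeasurable g ->
  cmeasurable (fun t => f t + g t).
Proof.
move=> [f1 f2] [g1 g2]; split.
- by under eq_fun do rewrite Re_addc; exact: measurable_funD.
- by under eq_fun do rewrite Im_addc; exact: measurable_funD.
Qed.

Lemma cmeasurableM f g : cmeasurable f -> cmeasurable g ->
  cmeasurable (fun t => f t * g t).
Proof.
move=> [f1 f2] [g1 g2]; split.
- under eq_fun do rewrite Re_mulc.
  by apply: measurable_funB; exact: measurable_funM.
- under eq_fun do rewrite Im_mulc.
  by apply: measurable_funD; exact: measurable_funM.
Qed.

Lemma cmeasurableB f g : cmeasurable f -> cmeasurable g ->
  cmeasurable (fun t => f t - g t).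
Proof.
move=> mf mg; under eq_fun do rewrite -mulN1r.
by apply: cmeasurableD => //; apply: cmeasurableM => //; exact: cmeasurable_cst.
Qed.

Lemma cmeasurableV f : cmeasurable f -> cmeasurable (fun t => (f t)^-1).
Proof.
move=> [f1 f2].
have mN : measurable_fun setT
    (fun t => (complex.Re (f t) ^+ 2 + complex.Im (f t) ^+ 2) `^ (-1)).
  apply: (measurableT_comp (measurable_powR (-1))).
  by apply: measurable_funD; exact: measurable_funX.
split.
- by under eq_fun do rewrite Re_invc; exact: measurable_funM.
- under eq_fun do rewrite Im_invc.
  by apply: measurableT_comp => //; exact: measurable_funM.
Qed.

Lemma cmeasurableX f n : cmeasurable f -> cmeasurable (fun t => f t ^+ n).
Proof.
move=> mf; elim: n => [|n IH]; first exact: cmeasurable_cst.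
by under eq_fun do rewrite exprS; exact: cmeasurableM.
Qed.

Lemma cmeasurable_sum (f : nat -> T -> R[i]) n :
  (forall k, cmeasurable (f k)) ->
  cmeasurable (fun t => \sum_(k < n) f k t).
Proof.
move=> mf; elim: n => [|n IH].
  by under eq_fun do rewrite big_ord0; exact: cmeasurable_cst.
by under eq_fun do rewrite big_ord_recr/=; exact: cmeasurableD.
Qed.

End ComplexMeasurable.

Section ComplexIntegral.
Variables (R : realType) (F : probability (measurableTypeR R) R) (L : R).
Hypothesis suppF : F (~` `[0, L]%classic) = 0%E.
Implicit Types (f g : measurableTypeR R -> R[i]) (c : R[i]) (M : R).

Lemma cintegrable_supported f M : cmeasurable f ->
  (forall x, 0 <= x <= L -> modc (f x) <= M) -> cintegrable F f.
Proof.
move=> [f1 f2] fM; split.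
- apply: (integrable_supported suppF f1 (M := M)) => x /fM.
  exact: le_trans (ler_Re_modc _).
- apply: (integrable_supported suppF f2 (M := M)) => x /fM.
  exact: le_trans (ler_Im_modc _).
Qed.

Lemma modc_cintegral_le f M : cmeasurable f ->
  (forall x, 0 <= x <= L -> modc (f x) <= M) ->
  modc (cintegral F f) <= M + M.
Proof.
move=> [f1 f2] fM; apply: (le_trans (ler_modc _)); rewrite /= lerD//.
- apply: (Rintegral_supported_le suppF f1) => x /fM.
  exact: le_trans (ler_Re_modc _).
- apply: (Rintegral_supported_le suppF f2) => x /fM.
  exact: le_trans (ler_Im_modc _).
Qed.

Lemma cintegralBZr f g c : cintegrable F f -> cintegrable F g ->
  cintegral F (fun x => f x - g x * c) = cintegral F f - cintegral F g * c.
Proof.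
move=> [f1 f2] [g1 g2].
have intZ (h : measurableTypeR R -> R) k : F.-integrable setT (fun x => (h x)%:E) ->
    F.-integrable setT (fun x => (k * h x)%:E).
  by move=> ih; exact: (integrableZl measurableT k ih).
have intD (h k : measurableTypeR R -> R) : F.-integrable setT (fun x => (h x)%:E) ->
    F.-integrable setT (fun x => (k x)%:E) ->
    F.-integrable setT (fun x => (h x + k x)%:E).
  by move=> ih ik; exact: (integrableD measurableT ih ik).
rewrite /cintegral; case: c => a b.
rewrite [RHS](_ : _ = (
   (\int[F]_t complex.Re (f t) + (- a * \int[F]_t complex.Re (g t)
      + b * \int[F]_t complex.Im (g t))) +i*
   (\int[F]_t complex.Im (f t) + (- b * \int[F]_t complex.Re (g t)
      + - a * \int[F]_t complex.Im (g t))))); last first.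
  by congr (_ +i* _); rewrite /=; ring.
congr (_ +i* _).
- rewrite -!RintegralZl// -RintegralD//; try exact: intZ.
  rewrite -RintegralD//; last by apply: intD; exact: intZ.
  apply: eq_Rintegral => x _.
  by case: (f x) (g x) => ? ? [? ?] /=; ring.
- rewrite -!RintegralZl// -RintegralD//; try exact: intZ.
  rewrite -RintegralD//; last by apply: intD; exact: intZ.
  apply: eq_Rintegral => x _.
  by case: (f x) (g x) => ? ? [? ?] /=; ring.
Qed.

(** Term-by-term integration from a remainder bound that is uniform on the support. Real and
    imaginary parts are bounded separately, which costs the factor 2 behind the tolerance t/2. *)
Lemma cvg_cintegral_series f (C : nat -> measurableTypeR R -> R[i])
    (e : nat -> R[i]) (eps : nat -> R) :
  cintegrable F f -> cmeasurable f ->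
  (forall n, cintegrable F (C n)) -> (forall n, cmeasurable (C n)) ->
  (forall N x, 0 <= x <= L -> modc (f x - \sum_(n < N) C n x * e n) <= eps N) ->
  eps N @[N --> \oo] --> (0 : R) ->
  series (fun n => cintegral F (C n) * e n : R[i]^o) @ \oo -->
    (cintegral F f : R[i]^o).
Proof.
move=> intf mf intC mC hN eps0; apply/cvg_modcP => t t0.
have mrem N : cmeasurable (fun x => f x - \sum_(n < N) C n x * e n).
  apply: cmeasurableB => //.
  apply: (cmeasurable_sum (f := fun n x => C n x * e n)) => n.
  by apply: cmeasurableM => //; exact: cmeasurable_cst.
have rem N : cintegral F (fun x => f x - \sum_(n < N) C n x * e n) =
    cintegral F f - \sum_(n < N) cintegral F (C n) * e n.
  elim: N => [|N IH].
    by rewrite big_ord0 subr0; congr cintegral; apply/funext => x; rewrite big_ord0 subr0.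
  rewrite big_ord_recr/= opprD addrA -IH -cintegralBZr//; last first.
    exact: cintegrable_supported (mrem N) (hN N).
  congr cintegral; apply/funext => x.
  by rewrite big_ord_recr/= opprD addrA.
have t2 : 0 < t / 2 by rewrite divr_gt0.
have [N _ epsN] : \forall n \near \oo, eps n < t / 2.
  by apply: (cvgr_lt (0 : R)).
exists N => n /epsN /= en.
rewrite modcB /series/= big_mkord -(rem n).
apply: (le_lt_trans (modc_cintegral_le (mrem n) (hN n))); lra.
Qed.

End ComplexIntegral.

(** * Taylor expansion of the resolvent *)

Section Resolvent.
Variables (R : realType) (F : probability (measurableTypeR R) R) (L : R).
Hypotheses (L0 : 0 < L) (suppF : F (~` `[0, L]%classic) = 0%E).
Implicit Types (w z : R[i]) (x : measurableTypeR R).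

(** L - w x can vanish with x in [0, L] only if w = L/x is real and at least 1. The squared modulus
    is a real polynomial in x, so it attains a positive minimum on [0, L]. *)
Lemma slit_plane_bound w : slit_plane w ->
  exists2 delta : R, 0 < delta &
    forall x : R, 0 <= x <= L -> delta <= modc (L%:C - w * x%:C).
Proof.
case: w => u v sw.
pose h (x : R) := (L - u * x) ^+ 2 + (v * x) ^+ 2.
have hE x : modc (L%:C - (u +i* v) * x%:C) ^+ 2 = h x.
  by rewrite sqr_modc /h /=; ring.
have ch : {within `[0, L], continuous h}.
  apply: continuous_subspaceT => x; apply: cvgD; apply: cvgM;
    try (apply: cvgB; first exact: cvg_cst);
    by apply: cvgM; [exact: cvg_cst|exact: cvg_id].
have [x0 x0L hmin] := EVT_min (ltW L0) ch.
move: x0L; rewrite in_itv/= => /andP[x00 x0L].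
have h0 : 0 < h x0.
  rewrite lt_neqAle addr_ge0 ?sqr_ge0// andbT eq_sym.
  apply/negP; rewrite paddr_eq0 ?sqr_ge0// !sqrf_eq0 mulf_eq0 => /andP[/eqP h1].
  have [x0_0|x0_neq0] := eqVneq x0 0.
    by move: h1; rewrite x0_0 mulr0 subr0 => L00; move: L0; rewrite L00 ltxx.
  rewrite orbF => /eqP v0; apply: sw; exists u; last by rewrite v0.
  rewrite /= in_itv/= andbT.
  have x0_gt0 : 0 < x0 by rewrite lt_neqAle eq_sym x0_neq0.
  rewrite -(ler_pM2r x0_gt0) mul1r; move: h1; lra.
exists (Num.sqrt (h x0)); first by rewrite sqrtr_gt0.
move=> x xL; rewrite -(ger0_norm (modc_ge0 _)) -sqrtr_sqr ler_sqrt ?sqr_ge0//.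
by rewrite hE; apply: hmin; rewrite in_itv.
Qed.

(** The Taylor coefficients at w of the function v -> v/(L - v x). *)
Definition resolvent_coef w n x : R[i] :=
  if n is m.+1 then L%:C * x%:C ^+ m / (L%:C - w * x%:C) ^+ m.+2
  else w / (L%:C - w * x%:C).

Lemma cmeasurable_den w : cmeasurable (fun x => L%:C - w * x%:C).
Proof.
apply: cmeasurableB; first exact: cmeasurable_cst.
apply: cmeasurableM; first exact: cmeasurable_cst.
by apply: (cmeasurable_real (h := idfun)); exact: measurable_id.
Qed.

Lemma cmeasurable_resolvent_coef w n : cmeasurable (resolvent_coef w n).
Proof.
case: n => [|n] /=.
  apply: cmeasurableM; first exact: cmeasurable_cst.
  exact/cmeasurableV/cmeasurable_den.
apply: cmeasurableM; last exact/cmeasurableV/cmeasurableX/cmeasurable_den.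
apply: cmeasurableM; first exact: cmeasurable_cst.
apply: cmeasurableX; apply: (cmeasurable_real (h := idfun)).
exact: measurable_id.
Qed.

Section Expansion.
Variables (w0 : R[i]) (delta : R).
Hypotheses (delta0 : 0 < delta)
  (hdelta : forall x : R, 0 <= x <= L -> delta <= modc (L%:C - w0 * x%:C)).

Lemma cintegrable_resolvent_coef n : cintegrable F (resolvent_coef w0 n).
Proof.
pose M : R := if n is m.+1 then L * L ^+ m / delta ^+ m.+2 else modc w0 / delta.
apply: (cintegrable_supported suppF (M := M)).
  exact: cmeasurable_resolvent_coef.
move=> x xL; have hx := hdelta xL; have /andP[x0 xL'] := xL.
have m0 : 0 < modc (L%:C - w0 * x%:C) := lt_le_trans delta0 hx.
rewrite /M; case: n {M} => [|n] /=.
  by rewrite modcM modcV ler_wpM2l ?modc_ge0// lef_pV2.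
rewrite !modcM modcV !modcX !modc_real (ger0_norm x0) (gtr0_norm L0).
apply: ler_pM.
- by rewrite mulr_ge0 ?(ltW L0)// exprn_ge0.
- by rewrite invr_ge0 exprn_ge0// modc_ge0.
- by rewrite ler_wpM2l ?(ltW L0)//; apply: lerXn2r => //; rewrite nnegrE ltW.
- rewrite lef_pV2 ?posrE ?exprn_gt0//.
  by apply: lerXn2r => //; rewrite nnegrE ltW.
Qed.

(** From order 1 on the Taylor terms are geometric with ratio (w - w0) x / (L - w0 x), so the
    remainder has a closed form. *)
Lemma resolvent_remainder w x N :
  L%:C - w0 * x%:C != 0 -> L%:C - w * x%:C != 0 ->
  w / (L%:C - w * x%:C) -
    \sum_(n < N.+1) resolvent_coef w0 n x * (w - w0) ^+ n =
  L%:C * (w - w0) * ((w - w0) * x%:C / (L%:C - w0 * x%:C)) ^+ N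
    / ((L%:C - w0 * x%:C) * (L%:C - w * x%:C)).
Proof.
move=> a0 b0; elim: N => [|N IH].
  rewrite big_ord_recr big_ord0/= add0r !expr0 !mulr1.
  by field; rewrite a0 b0.
rewrite big_ord_recr/= opprD addrA IH.
rewrite !exprMn !exprS !exprVn.
have aN : (L%:C - w0 * x%:C) ^+ N != 0 by rewrite expf_neq0.
by field; rewrite a0 b0 aN.
Qed.

(** The hypothesis bounds the geometric ratio by q for all x in [0, L] and keeps |L - w x| above (1
    - q) delta, so remainders decay like q^N uniformly. It is applied with w0 = 0 and q = |w| on the
    unit disc, with q = 1/2 for analyticity, and with w = w0 and q = 0 for bare integrability. *)
Lemma resolvent_expansion w (q : R) : 0 <= q < 1 ->
  modc (w - w0) * L <= q * delta ->
  cintegrable F (fun x => w / (L%:C - w * x%:C)) /\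
  series (fun n => cintegral F (resolvent_coef w0 n) * (w - w0) ^+ n : R[i]^o)
    @ \oo --> (cintegral F (fun x => w / (L%:C - w * x%:C)) : R[i]^o).
Proof.
move=> /andP[q0 q1] hw.
have den x : 0 <= x <= L -> (1 - q) * delta <= modc (L%:C - w * x%:C).
  move=> xL; have /andP[x0 xL'] := xL; have hx := hdelta xL.
  have E : L%:C - w0 * x%:C = (L%:C - w * x%:C) + (w - w0) * x%:C by ring.
  have : modc ((w - w0) * x%:C) <= q * delta.
    rewrite modcM modc_real (ger0_norm x0) (le_trans _ hw)//.
    by rewrite ler_wpM2l ?modc_ge0.
  have := modcD (L%:C - w * x%:C) ((w - w0) * x%:C); rewrite -E.
  by move: hx; lra.
have den0 : 0 < (1 - q) * delta by rewrite mulr_gt0// subr_gt0.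
have mf : cmeasurable (fun x => w / (L%:C - w * x%:C)).
  apply: cmeasurableM; first exact: cmeasurable_cst.
  exact/cmeasurableV/cmeasurable_den.
have intf : cintegrable F (fun x => w / (L%:C - w * x%:C)).
  apply: (cintegrable_supported suppF mf (M := modc w / ((1 - q) * delta))).
  move=> x /den hx; rewrite modcM modcV ler_wpM2l ?modc_ge0// lef_pV2 ?posrE//.
  exact: lt_le_trans hx.
split => //.
pose eps N : R := if N is n.+1 then
  q ^+ n * (L * modc (w - w0) / (delta * ((1 - q) * delta)))
  else modc w / ((1 - q) * delta).
apply: (cvg_cintegral_series suppF (eps := eps)) => //.
- exact: cintegrable_resolvent_coef.
- exact: cmeasurable_resolvent_coef.
- case=> [|N] x xL.
    rewrite big_ord0 subr0 /eps modcM modcV ler_wpM2l ?modc_ge0//.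
    have hd := den _ xL.
    by rewrite lef_pV2 ?posrE//; exact: lt_le_trans hd.
  have /andP[x0 xL'] := xL; have hx := hdelta xL; have hd := den _ xL.
  have m0 : 0 < modc (L%:C - w0 * x%:C) := lt_le_trans delta0 hx.
  have m1 : 0 < modc (L%:C - w * x%:C) := lt_le_trans den0 hd.
  rewrite resolvent_remainder; [|by rewrite -modc_gt0..].
  rewrite modcM modcV modcM modcX !modcM modcV !modc_real (ger0_norm x0) (gtr0_norm L0).
  rewrite /eps [leLHS](_ : _ = (modc (w - w0) * x / modc (L%:C - w0 * x%:C)) ^+ N *
    (L * modc (w - w0) / (modc (L%:C - w0 * x%:C) * modc (L%:C - w * x%:C))));
    last by ring.
  apply: ler_pM.
  + by rewrite exprn_ge0// divr_ge0 ?modc_ge0// mulr_ge0 ?modc_ge0.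
  + by rewrite divr_ge0 ?mulr_ge0 ?modc_ge0 ?(ltW L0).
  + apply: lerXn2r; rewrite ?nnegrE ?divr_ge0 ?mulr_ge0 ?modc_ge0//.
    rewrite ler_pdivrMr//; apply: (@le_trans _ _ (q * delta)).
      by rewrite (le_trans _ hw)// ler_wpM2l ?modc_ge0.
    by rewrite ler_wpM2l.
  + rewrite ler_wpM2l ?mulr_ge0 ?modc_ge0 ?(ltW L0)//.
    rewrite lef_pV2 ?posrE ?mulr_gt0 ?subr_gt0//.
    by apply: ler_pM => //; exact: ltW.
- have : eps n.+1 @[n --> \oo] --> (0 : R).
    rewrite -[X in _ --> X](mul0r (L * modc (w - w0) / (delta * ((1 - q) * delta)))).
    apply: cvgM; last exact: cvg_cst.
    by apply: cvg_expr; rewrite ger0_norm.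
  by rewrite (cvg_shiftS eps).
Qed.

End Expansion.

End Resolvent.

(** * Trigonometric moments *)

Section Trigonometric.
Variable R : realType.
Local Notation mu := (@lebesgue_measure R).
Implicit Types (x y u : R).

Definition cis x : R[i] := cos x +i* sin x.

Lemma cis0 : cis 0 = 1.
Proof. by rewrite /cis cos0 sin0. Qed.

Lemma cisD x y : cis (x + y) = cis x * cis y.
Proof. by rewrite /cis cosD sinD; congr (_ +i* _); ring. Qed.

Lemma cisX x n : cis x ^+ n = cis (n%:R * x).
Proof.
elim: n => [|n IH]; first by rewrite mul0r cis0.
by rewrite exprS IH -cisD -natr1 mulrDl mul1r addrC.
Qed.

Lemma two_cosE x : (2 * cos x)%:C = cis x + cis (- x).
Proof.
rewrite /cis cosN sinN; apply/eqP; rewrite eq_complex/= subrr eqxx andbT.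
by apply/eqP; ring.
Qed.

(** With t = pi u, the prefactor has frequency (r-1)k in t and the j-th binomial term (r+1)k - 2j.
    Their sum 2(rk - j) is even, so every term is periodic on [0,1] and the constant one is j =
    rk. *)
Lemma A_powerE r k u : A_ r u ^+ k =
  \sum_(j < (r.+1 * k).+1) 'C(r.+1 * k, j)%:R *
    cis (2 * pi * ((r * k)%:R - j%:R) * u).
Proof.
rewrite /A_.
have -> : cexp (((r%:R - 1) * pi)%:C * 'i%C * u%:C) = cis ((r%:R - 1) * pi * u).
  rewrite /cexp /= !(mulr0, mul0r, mulr1, subr0, add0r, addr0, oppr0) expR0.
  by rewrite mul1r.
rewrite exprMn cisX -rmorphXn/= -exprM rmorphXn/= two_cosE exprDn mulr_sumr.
apply: eq_bigr => j _; rewrite !cisX -[_ *+ 'C(_, _)]mulr_natl [LHS]mulrCA; congr (_ * _).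
rewrite -!cisD; congr cis.
have jN : (j <= r.+1 * k)%N by rewrite -ltnS.
by rewrite natrB// !natrM -[r.+1%:R]natr1; ring.
Qed.

Lemma sin_natr_2pi n : sin (n%:R * (2 * pi)) = 0 :> R.
Proof.
elim: n => [|n IH]; first by rewrite mul0r sin0.
by rewrite -natr1 mulrDl mul1r [2 * pi in X in _ + X]mulr_natl sinD2pi.
Qed.

Lemma cos_natr_2pi n : cos (n%:R * (2 * pi)) = 1 :> R.
Proof.
elim: n => [|n IH]; first by rewrite mul0r cos0.
by rewrite -natr1 mulrDl mul1r [2 * pi in X in _ + X]mulr_natl cosD2pi.
Qed.

Lemma continuous_scaled (f : R -> R) (c : R) : continuous f ->
  continuous (fun u => f (c * u)).
Proof.
move=> cf u; apply: continuous_comp; last exact: cf.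
by apply: cvgM; [exact: cvg_cst|exact: cvg_id].
Qed.

Lemma is_derive_scaled (f : R -> R) (df c u : R) :
  is_derive (c * u) 1 f df -> is_derive u 1 (fun v => f (c * v)) (df * c).
Proof.
move=> hf; have hc : is_derive u 1 (fun v : R => c * v) c.
  have h := is_deriveZ c (is_derive_id u (1 : R)).
  by apply: (is_derive_eq h); rewrite /GRing.scale/= mulr1.
exact: (@is_derive1_comp _ f (fun v : R => c * v) u _ _ hf hc).
Qed.

Lemma FTC_unit_smooth (G g : R -> R) : continuous g ->
  (forall u, is_derive u 1 G (g u)) ->
  (\int[mu]_(u in `[0%R, 1%R]) (g u)%:E = (G 1 - G 0)%:E)%E.
Proof.
move=> cg dG; have cG u : {for u, continuous G}.
  by have [/derivable1_diffP/differentiable_continuous] := dG u.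
rewrite (@continuous_FTC2 _ g G)//.
- exact: continuous_subspaceT.
- split; first by move=> u _; have [] := dG u.
  + by apply: cvg_at_right_filter; exact: cG.
  + by apply: cvg_at_left_filter; exact: cG.
- by move=> u _; rewrite derive1E; have [] := dG u.
Qed.

Lemma integral_cos_scaled c : c != 0 ->
  (\int[mu]_(u in `[0%R, 1%R]) (cos (c * u))%:E = (sin c / c)%:E)%E.
Proof.
move=> c0; transitivity (sin (c * 1) / c - sin (c * 0) / c)%:E; last first.
  by rewrite mulr1 mulr0 sin0 mul0r subr0.
apply: (@FTC_unit_smooth (fun u => sin (c * u) / c) (fun u => cos (c * u))).
  by apply: continuous_scaled; exact: continuous_cos.
move=> u; have h := is_derive_scaled (is_derive_sin (c * u)).
have h2 := is_deriveM h (is_derive_cst c^-1 u 1).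
by apply: (is_derive_eq h2); rewrite /GRing.scale/= mulr0 add0r mulrCA mulVf ?mulr1.
Qed.

Lemma integral_sin_scaled c : c != 0 ->
  (\int[mu]_(u in `[0%R, 1%R]) (sin (c * u))%:E = ((1 - cos c) / c)%:E)%E.
Proof.
move=> c0; transitivity (cos (c * 1) * - c^-1 - cos (c * 0) * - c^-1)%:E; last first.
  by rewrite mulr1 mulr0 cos0; congr (_%:E); ring.
apply: (@FTC_unit_smooth (fun u => cos (c * u) * - c^-1) (fun u => sin (c * u))).
  by apply: continuous_scaled; exact: continuous_sin.
move=> u; have h := is_derive_scaled (is_derive_cos (c * u)).
have h2 := is_deriveM h (is_derive_cst (- c^-1) u 1).
by apply: (is_derive_eq h2); rewrite /GRing.scale/= mulr0 add0r; field.
Qed.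

Lemma integral_cos_freq (m j : nat) :
  (\int[mu]_(u in `[0%R, 1%R]) (cos (2 * pi * (m%:R - j%:R) * u))%:E =
   ((j == m)%:R)%:E)%E.
Proof.
have [->|jm] := eqVneq.
  under eq_integral do rewrite subrr mulr0 mul0r cos0.
  by rewrite integral_cst//= lebesgue_measure_itv/= lte_fin ltr01 sube0 mul1e.
rewrite integral_cos_scaled; last first.
  have mj : m%:R - j%:R != 0 :> R by rewrite subr_eq0 eqr_nat eq_sym.
  by rewrite !mulf_neq0// gt_eqF// pi_gt0.
rewrite [X in sin X]mulrC mulrBl sinB !sin_natr_2pi !cos_natr_2pi.
by rewrite mul0r mulr0 subrr mul0r.
Qed.

Lemma integral_sin_freq (m j : nat) :
  (\int[mu]_(u in `[0%R, 1%R]) (sin (2 * pi * (m%:R - j%:R) * u))%:E = 0)%E.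
Proof.
have [->|jm] := eqVneq j m.
  by under eq_integral do rewrite subrr mulr0 mul0r sin0; rewrite integral0.
rewrite integral_sin_scaled; last first.
  have mj : m%:R - j%:R != 0 :> R by rewrite subr_eq0 eqr_nat eq_sym.
  by rewrite !mulf_neq0// gt_eqF// pi_gt0.
rewrite [X in cos X]mulrC [X in cos X]mulrBl cosB !sin_natr_2pi !cos_natr_2pi.
by rewrite mulr1 mulr0 addr0 subrr mul0r.
Qed.

Lemma Re_A_power r k u : complex.Re (A_ r u ^+ k) =
  \sum_(j < (r.+1 * k).+1) 'C(r.+1 * k, j)%:R *
    cos (2 * pi * ((r * k)%:R - j%:R) * u).
Proof.
rewrite A_powerE (big_morph _ (@Re_addc R) (erefl : complex.Re 0 = 0)).
by apply: eq_bigr => j _; rewrite Re_mulc -(rmorph_nat (real_complex R))/= mul0r subr0.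
Qed.

Lemma Im_A_power r k u : complex.Im (A_ r u ^+ k) =
  \sum_(j < (r.+1 * k).+1) 'C(r.+1 * k, j)%:R *
    sin (2 * pi * ((r * k)%:R - j%:R) * u).
Proof.
rewrite A_powerE (big_morph _ (@Im_addc R) (erefl : complex.Im 0 = 0)).
by apply: eq_bigr => j _; rewrite Im_mulc -(rmorph_nat (real_complex R))/= mul0r addr0.
Qed.

Lemma integrable_continuous_unit (f : R -> R) : continuous f ->
  mu.-integrable `[0, 1] (fun u => (f u)%:E).
Proof.
move=> cf; apply: continuous_compact_integrable; first exact: segment_compact.
exact: continuous_subspaceT.
Qed.

Lemma integral_Re_A_power r k :
  (\int[mu]_(u in `[0%R, 1%R]) (complex.Re (A_ r u ^+ k))%:E =
   ('C(r.+1 * k, k)%:R)%:E)%E.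
Proof.
under eq_integral do rewrite Re_A_power -sumEFin.
have int j : mu.-integrable `[0, 1]
    (fun u : R => (cos (2 * pi * ((r * k)%:R - j%:R) * u))%:E).
  apply: integrable_continuous_unit; apply: continuous_scaled.
  exact: continuous_cos.
under eq_integral do under eq_bigr do rewrite EFinM.
rewrite integral_sum//; last by move=> j; exact: integrableZl.
have rk : (r * k < (r.+1 * k).+1)%N by rewrite ltnS leq_mul2r leqnSn orbT.
rewrite (bigD1 (Ordinal rk))//= integralZl// integral_cos_freq eqxx mule1.
rewrite big1 ?adde0; last first.
  move=> j jrk; rewrite integralZl// integral_cos_freq.
  by rewrite (_ : (j == (r * k)%N :> nat) = false) ?mule0//; apply: negbTE.
by rewrite -bin_sub ?leq_mul2r ?leqnSn ?orbT// -mulnBl subSnn mul1n.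
Qed.

Lemma integral_Im_A_power r k :
  (\int[mu]_(u in `[0%R, 1%R]) (complex.Im (A_ r u ^+ k))%:E = 0)%E.
Proof.
under eq_integral do rewrite Im_A_power -sumEFin.
have int j : mu.-integrable `[0, 1]
    (fun u : R => (sin (2 * pi * ((r * k)%:R - j%:R) * u))%:E).
  apply: integrable_continuous_unit; apply: continuous_scaled.
  exact: continuous_sin.
under eq_integral do under eq_bigr do rewrite EFinM.
rewrite integral_sum//; last by move=> j; exact: integrableZl.
by rewrite big1// => j _; rewrite integralZl// integral_sin_freq mule0.
Qed.

Lemma measurable_A_power r k : cmeasurable (fun u : measurableTypeR R => A_ r u ^+ k).
Proof.
split.
- under eq_fun do rewrite Re_A_power.
  apply: measurable_sum => j; apply: measurable_funM => //.
  apply: continuous_measurable_fun; apply: continuous_scaled.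
  exact: continuous_cos.
- under eq_fun do rewrite Im_A_power.
  apply: measurable_sum => j; apply: measurable_funM => //.
  apply: continuous_measurable_fun; apply: continuous_scaled.
  exact: continuous_sin.
Qed.

Lemma A_power_bound r k u :
  `|complex.Re (A_ r u ^+ k)| <= \sum_(j < (r.+1 * k).+1) 'C(r.+1 * k, j)%:R /\
  `|complex.Im (A_ r u ^+ k)| <= \sum_(j < (r.+1 * k).+1) 'C(r.+1 * k, j)%:R.
Proof.
rewrite Re_A_power Im_A_power; split;
  apply: (le_trans (ler_norm_sum _ _ _)); apply: ler_sum => j _;
  rewrite normrM ger0_norm// ler_piMr// ler_norml.
- by rewrite cos_geN1 cos_le1.
- by rewrite sin_geN1 sin_le1.
Qed.

End Trigonometric.

(** * Fuss-Catalan moments and hypergeometric terms *)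

Section Combinatorics.
Variable R : realType.
Implicit Types (r k n : nat).

(** For r = 1 these are the Catalan numbers; the prefactor is 1/(k+1), where the Fuss-Catalan
    numbers have 1/(rk+1). *)
Definition fuss_moment r k : R := k.+1%:R^-1 * 'C(r.+1 * k, k)%:R.

(** The product of the rising factorials (j/p)_k for j = 1, ..., p, evaluated by Gauss's
    multiplication formula in [frac_risingE]. *)
Definition frac_rising (p : nat) (k : nat) : R :=
  \prod_(j < p) \prod_(i < k) (j.+1%:R / p%:R + i%:R).

Lemma prod_block p i : (0 < p)%N ->
  \prod_(j < p) (j.+1%:R / p%:R + i%:R : R) * (p * i)`!%:R =
    (p * i.+1)`!%:R / p%:R ^+ p.
Proof.
move=> p0; have p_neq0 : p%:R != 0 :> R by rewrite pnatr_eq0 -lt0n.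
(* The number m of factors is separated from the denominator p, so that the induction can run on m
   with p fixed. *)
have H m : \prod_(j < m) (j.+1%:R / p%:R + i%:R : R) * (p * i)`!%:R =
    (p * i + m)`!%:R / p%:R ^+ m.
  elim: m => [|m IH]; first by rewrite big_ord0 addn0 mul1r expr0 divr1.
  rewrite big_ord_recr/= mulrAC IH addnS factS natrM exprS.
  have pm : p%:R ^+ m != 0 :> R by rewrite expf_neq0.
  by rewrite -addnS natrD natrM; field; rewrite p_neq0 pm.
by rewrite H mulnS addnC.
Qed.

Lemma frac_risingE p k : (0 < p)%N ->
  frac_rising p k = (p * k)`!%:R / p%:R ^+ (p * k).
Proof.
move=> p0; have p_neq0 : p%:R != 0 :> R by rewrite pnatr_eq0 -lt0n.
rewrite /frac_rising exchange_big/=; elim: k => [|k IH].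
  by rewrite big_ord0 muln0 expr0 divr1.
by rewrite big_ord_recr/= IH mulrC mulrA prod_block// -mulrA -invfM -exprD mulnS.
Qed.

(** The last factor is (1)_k = k!. *)
Lemma frac_risingSr p k : frac_rising p.+1 k =
  (\prod_(j < p) \prod_(i < k) (j.+1%:R / p.+1%:R + i%:R)) * k`!%:R.
Proof.
rewrite /frac_rising big_ord_recr/= divff ?pnatr_eq0//; congr (_ * _).
elim: k => [|k IH]; first by rewrite big_ord0.
by rewrite big_ord_recr/= IH factS natrM mulrC nat1r.
Qed.

(** The parameters are such that j/(r+1) + j/(r(r+1)) = j/r, so the beta moments form a quotient of
    two Gauss products; k! removes the factor with j = r + 1 from the upper one. *)
Lemma prod_beta_moment_frac r k : (0 < r)%N ->
  \prod_(j < r) beta_moment (j.+1%:R / r.+1%:R)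
    (j.+1%:R / (r%:R * r.+1%:R)) k =
  (frac_rising r.+1 k / k`!%:R) / frac_rising r k :> R.
Proof.
move=> r0; have r_neq0 : r%:R != 0 :> R by rewrite pnatr_eq0 -lt0n.
have r1_neq0 : r.+1%:R != 0 :> R by rewrite pnatr_eq0.
have kf : k`!%:R != 0 :> R by rewrite pnatr_eq0 -lt0n fact_gt0.
rewrite frac_risingSr mulfK// /frac_rising -prodf_div; apply: eq_bigr => j _.
rewrite /beta_moment prodf_div; congr (_ / _); apply: eq_bigr => i _.
by congr (_ + _); rewrite -[r.+1%:R]nat1r; field; rewrite r_neq0 nat1r.
Qed.

(** Gauss's formula leaves the powers (r+1)^((r+1)k) and r^(rk), whose quotient is exactly L^k. *)
Lemma prod_beta_momentE r k : (0 < r)%N ->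
  Lr R r ^+ k * \prod_(j < r) beta_moment (j.+1%:R / r.+1%:R)
    (j.+1%:R / (r%:R * r.+1%:R)) k = ('C(r.+1 * k, k)%:R : R).
Proof.
move=> r0; have r_neq0 : r%:R != 0 :> R by rewrite pnatr_eq0 -lt0n.
have r1_neq0 : r.+1%:R != 0 :> R by rewrite pnatr_eq0.
have kf : k`!%:R != 0 :> R by rewrite pnatr_eq0 -lt0n fact_gt0.
have rkf : (r * k)`!%:R != 0 :> R by rewrite pnatr_eq0 -lt0n fact_gt0.
rewrite prod_beta_moment_frac//.
have bin : 'C(r.+1 * k, k)%:R * (k`!%:R * (r * k)`!%:R) = (r.+1 * k)`!%:R :> R.
  rewrite -!natrM; congr (_%:R).
  have kr : (k <= r.+1 * k)%N by exact: leq_pmull.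
  by rewrite -(bin_fact kr) mulSn addKn.
rewrite !frac_risingE// -bin /Lr expr_div_n -!exprM.
have h1 : r.+1%:R ^+ (r.+1 * k) != 0 :> R by rewrite expf_neq0.
have h2 : r%:R ^+ (r * k) != 0 :> R by rewrite expf_neq0.
by field; rewrite kf rkf h1 h2.
Qed.

End Combinatorics.

(** * Terms of the hypergeometric series *)

Section HyperTerm.
Variable R : realType.
Implicit Types (r k q : nat) (w : R[i]).

Lemma rising_real (x : R) n :
  rising x%:C n = (\prod_(i < n) (x + i%:R))%:C.
Proof.
rewrite rmorph_prod; apply: eq_bigr => i _.
by rewrite rmorphD/= rmorph_nat.
Qed.

(** The leading factors -j/(q+1) of the rising factorials give the sign and the factorial. The
    others, 1 - j/(q+1) + i, are again of the form j'/(q+1) + i with j' = q + 1 - j, whence the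
    reversal of the index. *)
Lemma rising_neg_fracs q k :
  \prod_(x <- [seq - (j%:R / q.+1%:R) | j <- iota 1 q]) rising x k.+1 =
  ((-1) ^+ q * q`!%:R / q.+1%:R ^+ q *
    \prod_(j < q) \prod_(i < k) (j.+1%:R / q.+1%:R + i%:R) : R)%:C.
Proof.
have -> : iota 1 q = index_iota 1 q.+1 by rewrite /index_iota subn1.
rewrite big_map big_add1/= big_mkord.
have E (j : 'I_q) : rising (- (j.+1%:R / q.+1%:R) : R[i]) k.+1 =
    (- (j.+1%:R / q.+1%:R) *
     \prod_(i < k) ((rev_ord j).+1%:R / q.+1%:R + i%:R) : R)%:C.
  rewrite -[- _](_ : (- (j.+1%:R / q.+1%:R) : R)%:C = _); last first.
    by rewrite rmorphN fmorph_div/= !rmorph_nat.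
  rewrite rising_real big_ord_recl/= addr0; congr (_ * _)%:C.
  apply: eq_bigr => i _; rewrite /bump/= add1n subnSK//.
  rewrite natrB; last exact: ltnW.
  rewrite -[i.+1%:R]natr1 -[q.+1%:R in RHS]natr1 -[q.+1%:R]natr1.
  by field; rewrite natr1.
rewrite (eq_bigr _ (fun j _ => E j)).
rewrite -rmorph_prod big_split/=; congr (_ * _)%:C; last first.
  by rewrite [RHS](reindex_inj rev_ord_inj).
have p0 : q.+1%:R != 0 :> R by [].
(* The denominator is generalised so that it stays fixed during the induction on q. *)
move: (q.+1%:R : R) p0 => p p0.
elim: q {E} => [|q IH]; first by rewrite big_ord0 !expr0 divr1 mul1r.
rewrite big_ord_recr/= IH factS natrM !exprS.
have pq : p ^+ q != 0 by rewrite expf_neq0.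
by field; rewrite p0 pq.
Qed.

Lemma prod_fracs_gt0 q k :
  0 < \prod_(j < q) \prod_(i < k) (j.+1%:R / q.+1%:R + i%:R) :> R.
Proof.
by apply: prodr_gt0 => j _; apply: prodr_gt0 => i _; rewrite ltr_wpDr// divr_gt0.
Qed.

Lemma hyper_term0 (a b : seq R[i]) w : hyper_term a b w 0 = 1.
Proof.
rewrite /hyper_term !big1 ?divr1 ?mul1r ?expr0 ?fact0 ?divr1// => x _;
  by rewrite /rising big_ord0.
Qed.

(** Splitting off the leading factors lowers the order from k + 1 to k and leaves a product of beta
    moments. The leading factors themselves contribute -r^r/(r+1)^r = -(r+1)/L, and 1/(k+1)!
    supplies the 1/(k+1) of the moment. *)
Lemma hyper_termS r k w : (0 < r)%N ->
  hyper_term [seq - (j%:R / r.+1%:R) | j <- iota 1 r]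
             [seq - (j%:R / r%:R) | j <- iota 1 r.-1] w k.+1 =
  - (r.+1%:R * fuss_moment R r k / Lr R r ^+ k.+1)%:C * w ^+ k.+1.
Proof.
case: r => // r _; rewrite /hyper_term !rising_neg_fracs.
have := prod_beta_momentE R k (ltn0Sn r).
set bm := \prod_(j < _) beta_moment _ _ _ => hbm.
set A := \prod_(j < r.+1) _; set B := \prod_(j < r) _.
have kf : k`!%:R != 0 :> R by rewrite pnatr_eq0 -lt0n fact_gt0.
have B0 : B != 0 by rewrite gt_eqF// prod_fracs_gt0.
have FB : frac_rising R r.+1 k = B * k`!%:R by rewrite frac_risingSr.
have FA : frac_rising R r.+2 k = A * k`!%:R by rewrite frac_risingSr.
have AB : A = bm * (B * k`!%:R).
  rewrite -FB /bm (prod_beta_moment_frac R k (ltn0Sn r)) FA mulfK// divfK// FB.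
  by rewrite mulf_neq0.
have L0 := Lr_gt0 R r.+1.
rewrite -fmorph_div -[in X in _ * X](rmorph_nat (real_complex R)) /=.
rewrite mulrCA mulrC -fmorphV -rmorphM/=; congr (_ * _); rewrite -rmorphN; congr (_%:C).
rewrite /fuss_moment -hbm AB !factS !natrM /Lr !exprS.
have e1 : r.+2%:R != 0 :> R by [].
have e2 : r.+1%:R != 0 :> R by [].
have e3 : (-1) ^+ r != 0 :> R by rewrite signr_eq0.
have e4 : r`!%:R != 0 :> R by rewrite pnatr_eq0 -lt0n fact_gt0.
have e5 : r.+2%:R ^+ r != 0 :> R by rewrite expf_neq0.
have e6 : r.+1%:R ^+ r != 0 :> R by rewrite expf_neq0.
have e7 : (r.+2%:R * (r.+2%:R * r.+2%:R ^+ r) / (r.+1%:R * r.+1%:R ^+ r)) ^+ k != 0 :> R.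
  by rewrite expf_neq0// !mulf_neq0// invr_eq0 mulf_neq0.
by field; rewrite e6 e7 e5 kf B0 e4 e3 !nat1r -[2 + _]natrD !pnatr_eq0.
Qed.

End HyperTerm.

(** * The Cauchy transform *)

Section FussSupport.
Variables (R : realType) (r : nat) (F : probability (measurableTypeR R) R).
Hypotheses (hr : (0 < r)%N)
  (hF : forall k, (\int[F]_x (x ^+ k)%:E = (fuss_moment R r k)%:E)%E).

(** The moments after rescaling by L to [0,1]. The uniform factor appears as B(1,1), so that
    [unit_positive_beta] applies to it as well. *)
Definition fuss_unit_moment k : R :=
  \prod_(j < r) beta_moment (j.+1%:R / r.+1%:R) (j.+1%:R / (r%:R * r.+1%:R)) k *
  beta_moment 1 1 k.

Lemma beta_moment11 k : beta_moment 1 1 k = k.+1%:R^-1 :> R.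
Proof.
rewrite /beta_moment; elim: k => [|k IH]; first by rewrite big_ord0 invr1.
rewrite big_ord_recr/= IH nat1r -addrA nat1r nat1r mulrA mulVf ?mul1r//.
Qed.

Lemma beta_parameters (j : 'I_r) :
  0 < (j.+1%:R / r.+1%:R : R) <= 1 /\
  0 < (j.+1%:R / (r%:R * r.+1%:R) : R) <= 1.
Proof.
have r0 : 0 < r%:R :> R by rewrite ltr0n.
have jr : j.+1%:R <= r%:R :> R by rewrite ler_nat.
split; apply/andP; split.
- by rewrite divr_gt0.
- by rewrite ler_pdivrMr// mul1r ler_nat ltnW// ltnS.
- by rewrite divr_gt0// mulr_gt0.
- rewrite ler_pdivrMr ?mulr_gt0// mul1r (le_trans jr)// ler_pMr//.
  by rewrite ler1n.
Qed.

Lemma fuss_unit_momentE k :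
  fuss_unit_moment k * Lr R r ^+ k = fuss_moment R r k.
Proof.
by rewrite /fuss_unit_moment beta_moment11 /fuss_moment -prod_beta_momentE//; ring.
Qed.

Lemma fuss_unit_positive : unit_positive fuss_unit_moment.
Proof.
apply: (@unit_positive_beta R _ 1 1); rewrite ?ltr01 ?lexx//.
apply: (@unit_positive_prod R _ (index_enum 'I_r)
  (fun j => j.+1%:R / r.+1%:R) (fun j => j.+1%:R / (r%:R * r.+1%:R))) => j.
- by have [] := beta_parameters j.
- by have [] := beta_parameters j.
Qed.

Lemma fuss_support : F (~` `[0, Lr R r]%classic) = 0%E.
Proof.
apply: (moment_support (Lr_gt0 R r) _ fuss_unit_positive).
- rewrite /fuss_unit_moment big1 ?mul1r => [|j _]; by rewrite /beta_moment big_ord0.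
- by move=> k; rewrite hF fuss_unit_momentE.
Qed.

End FussSupport.

Section CauchyTransform.
Variables (R : realType) (r : nat) (F : probability (measurableTypeR R) R).
Hypotheses (hr : (0 < r)%N)
  (hF : forall k, (\int[F]_x (x ^+ k)%:E = (fuss_moment R r k)%:E)%E).
Local Notation L := (Lr R r).
Let a : seq R[i] := [seq - (j%:R / r.+1%:R) | j <- iota 1 r].
Let b : seq R[i] := [seq - (j%:R / r%:R) | j <- iota 1 r.-1].
Let suppF := fuss_support hr hF.
Let L0 := Lr_gt0 R r.

Lemma cvg_series_affine (u : nat -> R[i]) (c l : R[i]) :
  (series (u : nat -> R[i]^o) @ \oo --> (l : R[i]^o)) ->
  series (fun n => (n == 0%N)%:R - c * u n : R[i]^o) @ \oo -->
    (1 - c * l : R[i]^o).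
Proof.
move=> /cvg_modcP ul; apply/cvg_modcP => e e0.
have c0 : 0 < modc c + 1 by rewrite ltr_wpDl// modc_ge0.
have [|N hN] := ul (e / (modc c + 1)); first by rewrite divr_gt0.
(* The empty partial sum lacks the constant term 1, so n must be positive. *)
exists (maxn N 1) => n; rewrite geq_max => /andP[Nn n0].
have -> : series (fun n => (n == 0%N)%:R - c * u n : R[i]^o) n =
    1 - c * series (u : nat -> R[i]^o) n :> R[i].
  rewrite /series/= sumrB mulr_sumr; congr (_ - _).
  case: n n0 {Nn} => // n _; rewrite big_nat_recl//= big1 ?addr0//.
set S := series _ n; rewrite (_ : _ - _ = c * (l - S)); last by ring.
rewrite modcM modcB.
apply: (@le_lt_trans _ _ ((modc c + 1) * modc (S - l))).
  by rewrite ler_wpM2r ?modc_ge0// lerDl.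
by rewrite mulrC -ltr_pdivlMr// hN.
Qed.

Lemma cvg_modc_unique (u : nat -> R[i]) (l1 l2 : R[i]) :
  ((u : nat -> R[i]^o) @ \oo --> (l1 : R[i]^o)) ->
  ((u : nat -> R[i]^o) @ \oo --> (l2 : R[i]^o)) -> l1 = l2.
Proof.
move=> /cvg_modcP u1 /cvg_modcP u2; apply/eqP; rewrite -subr_eq0 -modc_eq0.
rewrite eq_le modc_ge0 andbT; apply/ler_addgt0Pl => e e0; rewrite addr0.
have e2 : 0 < e / 2 by rewrite divr_gt0.
have [N1 h1] := u1 _ e2; have [N2 h2] := u2 _ e2.
have := h1 _ (leq_maxl N1 N2); have := h2 _ (leq_maxr N1 N2).
set v := u _; rewrite (_ : l1 - l2 = (l1 - v) + (v - l2)); last by rewrite addrA subrK.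
move=> ? ?; apply: (le_trans (modcD _ _)); rewrite modcB; lra.
Qed.

(** This is 1 - (r+1) G(L/w) with G the Cauchy transform of F, in a form that also makes sense at w
    = 0. *)
Definition fuss_continuation (w : R[i]) : R[i] :=
  1 - r.+1%:R * cintegral F (fun x : R => w / (L%:C - w * x%:C)).

(** At the centre 0 the coefficient of order m + 1 is x^m / L^(m+1), which yields the m-th moment
    with the same shift by one as in [hyper_termS]. *)
Lemma cintegral_resolvent_coef0 n :
  cintegral F (resolvent_coef L 0 n) =
  (if n is m.+1 then fuss_moment R r m / L ^+ m.+1 else 0)%:C.
Proof.
case: n => [|m].
  rewrite (_ : resolvent_coef L 0 0 = fun=> 0); last first.
    by apply/funext => x; rewrite /= mul0r.
  by rewrite /cintegral /= Rintegral_cst// mul0r.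
rewrite (_ : resolvent_coef L 0 m.+1 = fun x : R => (L ^- m.+1 * x ^+ m)%:C); last first.
  apply/funext => x; rewrite /resolvent_coef mul0r subr0.
  have -> : (L ^- m.+1 * x ^+ m)%:C = (L%:C ^+ m.+1)^-1 * x%:C ^+ m.
    by rewrite (rmorphM (real_complex R)) (fmorphV (real_complex R)) !(rmorphXn (real_complex R)).
  have LC : L%:C != 0 by rewrite fmorph_eq0 gt_eqF.
  rewrite [_ ^+ m.+2]exprS.
  by rewrite invfM mulrACA mulfV// mul1r mulrC.
rewrite /cintegral /= Rintegral_cst// mul0r; congr (_ +i* _).
rewrite RintegralZl//; last first.
  by apply: (integrable_moment (s := fuss_unit_moment R r) (L := L)) => k; rewrite hF fuss_unit_momentE.
by rewrite /Rintegral hF/= mulrC.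
Qed.

Lemma fuss_continuation_hypergeometric :
  is_hypergeometric a b fuss_continuation.
Proof.
split=> [w|w sw].
- rewrite modcE ltcR => w1.
  (* At the centre 0 the denominator is the constant L, so the expansion is valid exactly with q =
     |w| < 1. *)
  have h0 x : 0 <= x <= L -> L <= modc (L%:C - 0 * x%:C).
    by rewrite mul0r subr0 modc_real gtr0_norm.
  have [||_] := resolvent_expansion L0 suppF L0 h0 (w := w) (q := modc w).
  - by rewrite modc_ge0.
  - by rewrite subr0.
  rewrite subr0 => /(@cvg_series_affine _ r.+1%:R _); rewrite -/(fuss_continuation w).
  rewrite (_ : (fun n => (n == 0%N)%:R - _) = (hyper_term a b w : nat -> R[i]^o))//.
  apply/funext => -[|n]; rewrite cintegral_resolvent_coef0.
    by rewrite hyper_term0 mul0r mulr0 subr0.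
  rewrite sub0r hyper_termS// mulNr mulrA; congr (- (_ * _)).
  by rewrite -(rmorph_nat (real_complex R) r.+1) -rmorphM mulrA.
- have [delta delta0 hdelta] := slit_plane_bound L0 sw.
  exists (fun n => (n == 0%N)%:R - r.+1%:R * cintegral F (resolvent_coef L w n)).
  apply/near_modcP; exists (delta / (2 * L)); first by rewrite divr_gt0// mulr_gt0.
  move=> v vw.
  have [||_] := resolvent_expansion L0 suppF delta0 hdelta (w := v) (q := 2^-1).
  - by apply/andP; split; lra.
  - have : 2 * (modc (v - w) * L) < delta.
      have L20 : 0 < 2 * L by rewrite mulr_gt0.
      by move: vw; rewrite (ltr_pdivlMr _ _ L20) [_ * (2 * L)]mulrCA.
    by move: (modc (v - w) * L) => t; lra.
  move=> /(@cvg_series_affine _ r.+1%:R _); rewrite -/(fuss_continuation v).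
  rewrite (_ : (fun n => (n == 0%N)%:R - _) = (fun n => ((n == 0%N)%:R -
    r.+1%:R * cintegral F (resolvent_coef L w n)) * (v - w) ^+ n : R[i]^o))//.
  apply/funext => -[|n]; first by rewrite expr0 !mulr1.
  by rewrite !sub0r mulNr mulrA.
Qed.

(** [hypergeometric] picks some continuation if there is one; [fuss_continuation] is the witness. *)
Lemma hypergeometricP : is_hypergeometric a b (hypergeometric a b).
Proof. exact: (xgetPex _ (ex_intro _ _ fuss_continuation_hypergeometric)). Qed.

Lemma hypergeometricE w : slit_plane w -> hypergeometric a b w = fuss_continuation w.
Proof.
have [h1 h2] := hypergeometricP; have [c1 c2] := fuss_continuation_hypergeometric.
pose f w : R[i] := hypergeometric a b w - fuss_continuation w.
have f1 v : slit_plane v -> analytic_at f v.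
  by move=> sv; apply: analytic_atB; [apply: h2|apply: c2].
have f2 v : modc v < 1 -> f v = 0.
  move=> v1; have v1' : `|v| < 1 by rewrite modcE ltcR.
  by rewrite /f (cvg_modc_unique (h1 _ v1') (c1 _ v1')) subrr.
by move=> sw; have := slit_plane_identity f1 f2 sw; move/eqP; rewrite subr_eq0 => /eqP.
Qed.

Lemma cauchy_transform_fuss (z : R[i]) : ~ [set x%:C | x in `[0, L]] z ->
  cintegrable F (fun x : R => (z - x%:C)^-1) /\
  cauchy_transform F z = r.+1%:R^-1 * (1 - hypergeometric a b (L%:C / z)).
Proof.
move=> zL.
have LC : L%:C != 0 by rewrite fmorph_eq0 gt_eqF.
have z0 : z != 0.
  apply/eqP => z0; apply: zL; exists 0; last by rewrite z0.
  by rewrite /= in_itv/= lexx ltW.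
have sw : slit_plane (L%:C / z).
  move=> [x]; rewrite /= in_itv/= andbT => x1 xE; apply: zL.
  have x0 : 0 < x by rewrite (lt_le_trans ltr01).
  exists (L / x).
    rewrite /= in_itv/= divr_ge0 ?(ltW L0) ?(ltW x0)//= ler_pdivrMr//.
    by rewrite ler_peMr// ltW.
  by rewrite fmorph_div/= xE invf_div mulrC divfK.
have E (x : R) : (z - x%:C)^-1 = L%:C / z / (L%:C - L%:C / z * x%:C).
  have -> : L%:C - L%:C / z * x%:C = L%:C / z * (z - x%:C).
    by field.
  by rewrite invfM mulrA mulfV ?mul1r// mulf_neq0 ?invr_eq0.
have [delta delta0 hdelta] := slit_plane_bound L0 sw.
have [||int _] := resolvent_expansion L0 suppF delta0 hdelta (w := L%:C / z) (q := 0).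
- by rewrite lexx ltr01.
- by rewrite subrr modc0 !mul0r.
rewrite /cauchy_transform (_ : (fun x : R => (z - x%:C)^-1) =
  (fun x : R => L%:C / z / (L%:C - L%:C / z * x%:C))); last first.
  by apply/funext => x; exact: E.
split; first exact: int.
rewrite hypergeometricE// /fuss_continuation opprB addrC subrK mulrA.
by rewrite mulVf ?mul1r// pnatr_eq0.
Qed.

End CauchyTransform.

(** * Laws of random variables *)

Section LawOfRandomVariable.
Context d (T : measurableType d) (R : realType) (Q : probability T R).
Implicit Types (X : {RV Q >-> measurableTypeR R}) (f : R -> R).

Lemma measurable_RV X : measurable_fun setT (X : T -> measurableTypeR R).
Proof. exact: (measurable_funPT X). Qed.

Lemma law_null_ae X (nu : set (measurableTypeR R) -> \bar R) (S : set R) :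
  measurable (S : set (measurableTypeR R)) ->
  eq_law (distribution Q X) nu -> nu (~` S) = 0%E ->
  {ae Q, forall t, S (X t)}.
Proof.
move=> mS XE nuS; have mSC := measurableC mS.
exists (X @^-1` (~` S)); split => //.
- by rewrite -[_ @^-1` _]setTI; exact: measurable_RV.
- by have := XE _ mSC; rewrite nuS.
Qed.

Lemma ge0_integral_density X (p f : measurableTypeR R -> R) :
  measurable_fun setT p -> (forall x, 0 <= p x) ->
  eq_law (distribution Q X)
    (fun A => \int[@lebesgue_measure R]_(x in A) (p x)%:E)%E ->
  measurable_fun setT f -> (forall x, 0 <= f x) ->
  (\int[Q]_t (f (X t))%:E = \int[@lebesgue_measure R]_x (f x * p x)%:E)%E.
Proof.
move=> mp p0 XE mf f0.
have key A : measurable A -> (\int[Q]_t (\1_A (X t) * 1)%:E =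
    \int[@lebesgue_measure R]_x (\1_A (id x) * p x)%:E)%E.
  move=> mA; have := XE _ mA; rewrite /= => E.
  transitivity (Q (X @^-1` A)).
    under eq_integral do rewrite mulr1.
    have mXA : measurable (X @^-1` A).
      by rewrite -[_ @^-1` _]setTI; exact: measurable_RV.
    transitivity (\int[Q]_t (\1_(X @^-1` A) t)%:E)%E; first by [].
    by rewrite integral_indic// setIT.
  rewrite [LHS]E integral_mkcond; apply: eq_integral => x _.
  rewrite patchE indicE; case: (x \in A); first by rewrite mul1r.
  by rewrite mul0r.
have mfE : measurable_fun setT (EFin \o f) by apply/measurable_EFinP.
have := eq_weighted_integral (measurable_RV X) (@measurable_id _ _ setT)
  (measurable_cst (1 : R)) mp (fun=> ler01) p0 key mfE.
move=> /(_ _)/=; under eq_integral do rewrite mule1.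
by apply => x; rewrite lee_fin.
Qed.



(* The value of the Gamma factor is irrelevant: the law has total mass 1. *)
Lemma expectation_beta X (a b : R) k : 0 < a -> 0 < b ->
  eq_law (distribution Q X) (beta_law a b) ->
  {ae Q, forall t, 0 <= X t} /\
  (\int[Q]_t (`|X t| ^+ k)%:E = (beta_moment a b k)%:E)%E.
Proof.
move=> a0 b0 XE.
pose c : R := Gamma (a + b) / (Gamma a * Gamma b).
have Gamma_ge0 (y : R) : 0 <= Gamma y.
  by apply: Rintegral_ge0 => x _; rewrite mulr_ge0 ?powR_ge0 ?expR_ge0.
have c0 : 0 <= c by rewrite divr_ge0 ?mulr_ge0.
have pE x : beta_density a b x = (\1_(`]0, 1[%classic) x) * (c * beta_kernel a b x).
  rewrite /beta_density indicE; case: ifPn => x01.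
    by rewrite mem_set/= ?mul1r ?mulrA// in_itv.
  by rewrite memNset/= ?mul0r// in_itv/=; exact/negP.
have mp : measurable_fun setT (beta_density a b : measurableTypeR R -> R).
  rewrite (_ : beta_density a b = fun x => (\1_(`]0, 1[%classic) x) *
    (c * beta_kernel a b x)); last by apply/funext.
  apply: measurable_funM; first exact: measurable_indic.
  by apply: measurable_funM => //; exact: measurable_beta_kernel.
have p0 x : 0 <= beta_density a b x.
  rewrite pE mulr_ge0 ?(mulr_ge0 c0)//; exact: beta_kernel_ge0.
(* Absolute values make the integrand nonnegative on the whole line, as [ge0_integral_density] asks;
   they disappear on ]0,1[, where the density lives. *)
have mom j : (\int[Q]_t (`|X t| ^+ j)%:E = c%:E *
    \int[@lebesgue_measure R]_(x in `]0%R, 1%R[) (x ^+ j * beta_kernel a b x)%:E)%E.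
  rewrite (ge0_integral_density mp p0 XE (f := fun x => `|x| ^+ j)); last 2 first.
  - by apply: measurable_funX; exact: normr_measurable.
  - by move=> x; rewrite exprn_ge0.
  rewrite -ge0_integralZl_EFin//; last 2 first.
  - move=> x; rewrite /= in_itv/= => /andP[x0 _].
    by rewrite lee_fin mulr_ge0 ?beta_kernel_ge0// exprn_ge0// ltW.
  - apply/measurable_EFinP; apply: measurable_funM; first exact: measurable_funX.
    exact: measurable_beta_kernel.
  rewrite [RHS]integral_mkcond; apply: eq_integral => x _.
  rewrite patchE pE indicE; case: ifPn => x01; last by rewrite mul0r mulr0.
  move: x01 => /set_mem; rewrite /= in_itv/= => /andP[x0 _].
  by rewrite mul1r ger0_norm ?ltW// -EFinM mulrCA.
have cI : (c%:E * beta_integral a b = 1)%E.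
  have := mom 0%N; under eq_integral do rewrite expr0.
  have -> : (\int[Q]_t (cst 1%:E t) = 1)%E.
    by rewrite integral_cst// mul1e; exact: probability_setT.
  by move=> ->; congr (_ * _)%E; apply: eq_integral => x _; rewrite expr0 mul1r.
(* An infinite integral times the constant c would be 0 or infinite, never 1. *)
have fin : (beta_integral a b < +oo)%E.
  rewrite ltey; apply/eqP => Ioo; move: cI; rewrite Ioo.
  have [->|c_neq0] := eqVneq c 0; first by rewrite mul0e => /eqP; rewrite lt_eqF.
  by rewrite gt0_muley// lte_fin lt_neqAle eq_sym c_neq0.
split; last first.
  by rewrite mom integral_expr_beta_kernel// muleCA cI mule1.
apply: (@law_null_ae X _ [set x | 0 <= x]) XE _.
  rewrite (_ : [set x | 0 <= x] = `[0, +oo[%classic)//.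
  by apply/seteqP; split=> x /=; rewrite in_itv/= andbT.
rewrite /beta_law integral0_eq// => x /= /negP x0.
by rewrite /beta_density ifF//; apply/negbTE; apply: contra x0 => /andP[/ltW].
Qed.

Lemma expectation_uniform X (L : R) (L0 : 0 < L) k :
  eq_law (distribution Q X) (uniform_prob L0) ->
  {ae Q, forall t, 0 <= X t} /\
  (\int[Q]_t (`|X t| ^+ k)%:E = (L ^+ k / k.+1%:R)%:E)%E.
Proof.
move=> XE; split.
  apply: (@law_null_ae X _ [set x | 0 <= x]) XE _.
    rewrite (_ : [set x | 0 <= x] = `[0, +oo[%classic)//.
    by apply/seteqP; split=> x /=; rewrite in_itv/= andbT.
  rewrite /uniform_prob integral0_eq// => x /= /negP x0.
  by rewrite /uniform_pdf ifF//; apply/negbTE; apply: contra x0 => /andP[].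
have mf : measurable_fun setT (fun x : measurableTypeR R => (`|x| ^+ k)%:E).
  by apply/measurable_EFinP; apply: measurable_funX; exact: normr_measurable.
have f0 (x : measurableTypeR R) : (0 <= (`|x| ^+ k)%:E)%E by rewrite lee_fin exprn_ge0.
transitivity (\int[distribution Q X]_x (`|x| ^+ k)%:E)%E.
  by rewrite ge0_integral_distribution.
rewrite (@eq_measure_integral _ _ _ setT (uniform_prob L0)); last first.
  by move=> A mA _; exact: XE.
rewrite integral_uniform// subr0.
under eq_integral.
  move=> x /set_mem; rewrite /= in_itv/= => /andP[x0 _].
  rewrite ger0_norm; first over.
  exact: x0.
have dG (u : R) : is_derive u 1 (fun x : R => x ^+ k.+1 / k.+1%:R) (u ^+ k).
  have hX : is_derive u 1 (fun x : R => x ^+ k.+1) (k.+1%:R * u ^+ k).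
    rewrite (_ : (fun x : R => x ^+ k.+1) = (@idfun R) ^+ k.+1); last first.
      by apply/funext => x; rewrite exprfctE.
    apply: is_derive_eq; rewrite /GRing.scale/= mulr1 mulr_natl.
    by [].
  have h := is_deriveM hX (is_derive_cst (k.+1%:R^-1 : R) u 1).
  by apply: (is_derive_eq h); rewrite /GRing.scale/= mulr0 add0r mulrA mulVf ?mul1r.
have cG (u : R) : {for u, continuous (fun x : R => x ^+ k.+1 / k.+1%:R)}.
  by have [/derivable1_diffP/differentiable_continuous] := dG u.
rewrite (@continuous_FTC2 _ _ (fun x : R => x ^+ k.+1 / k.+1%:R))//.
- rewrite -EFinB -EFinM expr0n/= mul0r subr0 exprS; congr (_%:E).
  by field; rewrite nat1r pnatr_eq0/= gt_eqF.
- by apply: continuous_subspaceT => x; exact: exprn_continuous.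
- split; first by move=> u _; have [] := dG u.
  + by apply: cvg_at_right_filter; exact: cG.
  + by apply: cvg_at_left_filter; exact: cG.
- by move=> u _; rewrite derive1E; have [] := dG u.
Qed.

End LawOfRandomVariable.

(** In the independent family the index [None] stands for the uniform factor; it is split off
    here. *)
Lemma big_option (S : Type) (idx : S) (op : Monoid.com_law idx) (I : finType)
    (f : option I -> S) :
  \big[op/idx]_(i : option I) f i =
  op (f None) (\big[op/idx]_(j : I) f (Some j)).
Proof.
rewrite (bigD1 None)//=; congr (op _ _).
rewrite (reindex_omap Some id)/=; last by case.
by apply: eq_bigl => j; rewrite eqxx.
Qed.

(** * Law of the product of a uniform and beta variables *)

Section ProductLaw.
Variables (R : realType) (r : nat).
Hypothesis hr : (0 < r)%N.
Context d (T : measurableType d) (Q : probability T R).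
Variables (U : {RV Q >-> measurableTypeR R}) (B : 'I_r -> {RV Q >-> measurableTypeR R}).
Hypothesis lawU : eq_law (distribution Q U) (uniform_prob (Lr_gt0 R r)).
Hypothesis lawB : forall j : 'I_r, eq_law (distribution Q (B j))
  (beta_law (j.+1%:R / r.+1%:R) (j.+1%:R / (r%:R * r.+1%:R))).
Hypothesis indep :
  independent Q (fun i : option 'I_r => if i is Some j then B j else U).

Let W t := U t * \prod_(j < r) B j t.

Lemma measurable_product : measurable_fun setT (W : T -> measurableTypeR R).
Proof.
apply: measurable_funM; first exact: measurable_RV.
by apply: measurable_prod => j _; exact: measurable_RV.
Qed.

Lemma product_ge0 : {ae Q, forall t, 0 <= W t}.
Proof.
have U0 := (expectation_uniform 0 lawU).1.
have B0 : {ae Q, forall t, forall j, 0 <= B j t}.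
  apply: filter_forall => j.
  have [/andP[a0 _] /andP[b0 _]] := beta_parameters R hr j.
  exact: (expectation_beta 0 a0 b0 (lawB j)).1.
apply: filterS2 U0 B0 => t U0 B0.
by rewrite mulr_ge0// prodr_ge0.
Qed.

(** The factors are nonnegative only almost surely, so the product rule is applied to absolute
    values; they are removed in [expectation_product]. *)
Lemma expectation_normr_product k :
  (\int[Q]_t (`|W t| ^+ k)%:E = (fuss_moment R r k)%:E)%E.
Proof.
pose X i : {RV Q >-> measurableTypeR R} := if i is Some j then B j else U.
have indX : independent Q (fun i => X i : T -> R).
  rewrite (_ : (fun i => X i : T -> R) =
    (fun i => if i is Some j then B j : T -> R else U : T -> R))//.
  by apply/funext => -[].
have EU := (expectation_uniform k lawU).2.
have EB (j : 'I_r) : (\int[Q]_t (`|B j t| ^+ k)%:E = (beta_moment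
    (j.+1%:R / r.+1%:R) (j.+1%:R / (r%:R * r.+1%:R)) k)%:E)%E.
  have [/andP[a0 _] /andP[b0 _]] := beta_parameters R hr j.
  exact: (expectation_beta k a0 b0 (lawB j)).2.
transitivity (\int[Q]_t (\prod_i `|X i t| ^+ k)%:E)%E.
  apply: eq_integral => t _; rewrite big_option/= /W normrM exprMn.
  by rewrite normr_prod prodrXl.
rewrite (independent_expectation_prod indX (f := fun _ x => `|x| ^+ k)); first last.
- by move=> [j|]; rewrite ?EU ?EB ltry.
- by move=> i x; rewrite exprn_ge0.
- by move=> i; apply: measurable_funX; exact: normr_measurable.
rewrite big_option/= EU (eq_bigr _ (fun j _ => EB j)) prodEFin -EFinM.
by congr (_%:E); rewrite mulrAC prod_beta_momentE// mulrC.
Qed.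

Lemma integrable_product k : Q.-integrable setT (fun t => (W t ^+ k)%:E).
Proof.
apply/integrableP; split.
  by apply/measurable_EFinP; apply: measurable_funX; exact: measurable_product.
under eq_integral do rewrite /= normrX.
by rewrite expectation_normr_product ltry.
Qed.

Lemma expectation_product k :
  (\int[Q]_t (W t ^+ k)%:E = (fuss_moment R r k)%:E)%E.
Proof.
rewrite -expectation_normr_product; apply: ae_eq_integral => //.
- by apply/measurable_EFinP; apply: measurable_funX; exact: measurable_product.
- apply/measurable_EFinP; apply: measurable_funX.
  by apply: measurableT_comp; [exact: normr_measurable|exact: measurable_product].
- by apply: filterS product_ge0 => t W0 _ /=; rewrite ger0_norm.
Qed.

Lemma product_law (F : probability (measurableTypeR R) R) :
  (forall k, (\int[F]_x (x ^+ k)%:E = (fuss_moment R r k)%:E)%E) ->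
  eq_law F (pushforward Q W).
Proof.
move=> hF.
(* Packed as a random variable, [W] has a probability as its law, to which the support result
   applies as it does to F. *)
pose mW := isMeasurableFun.Build _ _ _ _ (W : T -> measurableTypeR R) measurable_product.
pose W' : {RV Q >-> measurableTypeR R} := HB.pack (W : T -> measurableTypeR R) mW.
have hG k : (\int[distribution Q W']_x (x ^+ k)%:E = (fuss_moment R r k)%:E)%E.
  rewrite integral_distribution//; first exact: expectation_product.
    by apply/measurable_EFinP; exact: measurable_funX.
  exact: integrable_product.
apply: (moment_determinacy (Lr_gt0 R r) (fuss_support hr hF)
  (fuss_support hr hG)) => k.
by rewrite hF hG.
Qed.

End ProductLaw.

(** * Moments of the complex representation *)

Section ComplexRepresentation.
Variables (R : realType) (r : nat).
Context d (T : measurableType d) (Q : probability T R).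
Variables (U U' : {RV Q >-> measurableTypeR R}).
Hypothesis lawU : eq_law (distribution Q U) (uniform_prob (@ltr01 R)).
Hypothesis lawU' : eq_law (distribution Q U') (uniform_prob (@ltr01 R)).
Hypothesis indep : independent Q (fun i : bool => if i then U' else U).
Local Notation mu := (@lebesgue_measure R).

Lemma expectation_power_fun_ge0 k (g : measurableTypeR R -> R) (M : R) :
  measurable_fun setT g -> (forall x, 0 <= g x <= M) ->
  (\int[Q]_t (`|U t| ^+ k * g (U' t))%:E =
   (k.+1%:R^-1)%:E * \int[mu]_(x in `[0%R, 1%R]) (g x)%:E)%E.
Proof.
move=> mg gM.
have g0 x : 0 <= g x by have /andP[] := gM x.
pose X (i : bool) : {RV Q >-> measurableTypeR R} := if i then U' else U.
have indX : independent Q (fun i => X i : T -> R) by exact: indep.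
have EU := (expectation_uniform k lawU).2.
rewrite expr1n div1r in EU.
have mgE : measurable_fun setT (EFin \o g) by apply/measurable_EFinP.
have EU' : (\int[Q]_t (g (U' t))%:E = \int[mu]_(x in `[0%R, 1%R]) (g x)%:E)%E.
  transitivity (\int[distribution Q U']_x (g x)%:E)%E.
    by rewrite ge0_integral_distribution// => x; rewrite lee_fin.
  rewrite (@eq_measure_integral _ _ _ setT (uniform_prob (@ltr01 R))); last first.
    by move=> A mA _; exact: lawU'.
  rewrite integral_uniform//.
  by rewrite subr0 invr1 mul1e.
have EU'_fin : (\int[Q]_t (g (U' t))%:E < +oo)%E.
  apply: (@le_lt_trans _ _ (\int[Q]_t (cst M%:E t))%E); last first.
    have -> : (\int[Q]_t (cst M%:E t) = M%:E * Q setT)%E by exact: integral_cst.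
    by have -> : (Q setT = 1)%E; [exact: probability_setT|rewrite mule1 ltry].
  have mgU' : measurable_fun setT (fun t => (g (U' t))%:E).
    by apply: (measurableT_comp mgE); exact: measurable_RV.
  have le_gM t : setT t -> ((g (U' t))%:E <= cst M%:E t)%E.
    by move=> _; rewrite lee_fin; have /andP[] := gM (U' t).
  by apply: ge0_le_integral => // t _; rewrite lee_fin.
pose f (i : bool) (x : R) : R := if i then g x else `|x| ^+ k.
transitivity (\int[Q]_t (\prod_i f i (X i t))%:E)%E.
  by apply: eq_integral => t _; rewrite big_bool /f /= mulrC.
rewrite (independent_expectation_prod indX (f := f)); first last.
- by case; rewrite /f /=; [exact: EU'_fin|rewrite EU ltry].
- by case=> x; rewrite /f ?g0// exprn_ge0.
- by case; rewrite /f//; apply: measurable_funX; exact: normr_measurable.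
by rewrite big_bool /f /= EU' EU muleC.
Qed.

(** A bounded signed g is shifted to the nonnegative g + M; the product rule for g + M and for the
    constant M gives the one for g by subtraction. Almost surely U equals |U|. *)
Lemma expectation_power_fun k (g : measurableTypeR R -> R) (M : R) :
  measurable_fun setT g -> (forall x, `|g x| <= M) ->
  Q.-integrable setT (fun t => (U t ^+ k * g (U' t))%:E) /\
  (\int[Q]_t (U t ^+ k * g (U' t))%:E =
   (k.+1%:R^-1)%:E * \int[mu]_(x in `[0%R, 1%R]) (g x)%:E)%E.
Proof.
move=> mg gM.
have M0 : 0 <= M := le_trans (normr_ge0 _) (gM 0).
have mU : measurable_fun setT (U : T -> R) by exact: measurable_RV.
have mgU' : measurable_fun setT (fun t => g (U' t)).
  by apply: (measurableT_comp mg); exact: measurable_RV.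
have mnU : measurable_fun setT (fun t => `|U t| ^+ k).
  by apply: measurable_funX; apply: measurableT_comp => //; exact: normr_measurable.
have EM := @expectation_power_fun_ge0 k (fun=> M) M (measurable_cst _).
rewrite integral_cst//= lebesgue_measure_itv/= lte_fin ltr01 sube0 mule1 in EM.
have {}EM := EM (fun=> introT andP (conj M0 (lexx M))).
have intnM : Q.-integrable setT (fun t => (`|U t| ^+ k * M)%:E).
  apply/integrableP; split.
    by apply/measurable_EFinP; exact: measurable_funM.
  under eq_integral do rewrite /= ger0_norm ?mulr_ge0 ?exprn_ge0//.
  by rewrite EM ltry.
have dom (h : T -> R) : measurable_fun setT h -> (forall t, `|h t| = `|U t| ^+ k) ->
    Q.-integrable setT (fun t => (h t * g (U' t))%:E).
  move=> mh hE; apply: (le_integrable measurableT _ _ intnM).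
    by apply/measurable_EFinP; exact: measurable_funM.
  move=> t _; rewrite /= lee_fin !normrM hE (ger0_norm M0).
  have Uk : 0 <= `|U t| ^+ k by rewrite exprn_ge0.
  by rewrite (ger0_norm Uk) ler_wpM2l.
have intU : Q.-integrable setT (fun t => (U t ^+ k * g (U' t))%:E).
  by apply: dom => [|t]; [exact: measurable_funX|rewrite normrX].
have intnU : Q.-integrable setT (fun t => (`|U t| ^+ k * g (U' t))%:E).
  by apply: dom => // t; rewrite ger0_norm// exprn_ge0.
split => //.
transitivity (\int[Q]_t (`|U t| ^+ k * g (U' t))%:E)%E.
  apply: ae_eq_integral => //.
  - exact: (measurable_int _ intU).
  - exact: (measurable_int _ intnU).
  - by apply: filterS (expectation_uniform 0 lawU).1 => t U0 _ /=; rewrite ger0_norm.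
have intM : mu.-integrable `[0%R, 1%R] (fun=> M%:E : \bar R).
  apply/integrableP; split; first exact/measurable_EFinP.
  under eq_integral do rewrite /= (ger0_norm M0).
  by rewrite integral_cst//= lebesgue_measure_itv/= lte_fin ltr01 sube0 mule1 ltry.
have intg : mu.-integrable `[0%R, 1%R] (fun x => (g x)%:E).
  have mI : measurable (`[0, 1]%classic : set (measurableTypeR R)) by [].
  have mgI : measurable_fun (`[0, 1]%classic : set (measurableTypeR R)) (EFin \o g).
    by apply/measurable_EFinP; exact: measurable_funTS.
  apply: (@le_integrable _ _ _ mu _ mI (EFin \o g) (fun=> M%:E) mgI _ intM).
  by move=> x _; rewrite /= lee_fin (ger0_norm M0).
have bnd x : 0 <= g x + M <= M + M by have := gM x; rewrite ler_norml; lra.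
have := expectation_power_fun_ge0 k (measurable_funD mg (measurable_cst M)) bnd.
have -> : (\int[Q]_t (`|U t| ^+ k * (g (U' t) + M))%:E =
    \int[Q]_t (`|U t| ^+ k * g (U' t))%:E + (k.+1%:R^-1)%:E * M%:E)%E.
  under eq_integral do rewrite mulrDr EFinD.
  by rewrite integralD// EM.
have -> : (\int[mu]_(x in `[0%R, 1%R]) (g x + M)%:E =
    \int[mu]_(x in `[0%R, 1%R]) (g x)%:E + M%:E)%E.
  under eq_integral do rewrite EFinD.
  rewrite integralD//; congr (_ + _)%E.
  by rewrite integral_cst//= lebesgue_measure_itv/= lte_fin ltr01 sube0 mule1.
have fin1 := integrable_fin_num measurableT intnU.
have fin2 : (\int[mu]_(x in `[0%R, 1%R]) (g x)%:E)%E \is a fin_num.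
  by apply: integrable_fin_num => //; exact: intg.
move: fin1 fin2; set A := (\int[Q]_t _)%E; set B := (\int[mu]_(x in _) _)%E.
case: A => // x _; case: B => // y _ H.
have H' : (x + k.+1%:R^-1 * M)%:E = (k.+1%:R^-1 * (y + M))%:E by exact: H.
by have := EFin_inj H'; rewrite mulrDr => /addIr ->; rewrite EFinM.
Qed.

(** U^k is real, so the real and imaginary parts of the integrand are U^k times bounded functions of
    U'. *)
Lemma cintegral_power_A k :
  cintegrable Q (fun t => ((U t)%:C * A_ r (U' t)) ^+ k) /\
  cintegral Q (fun t => ((U t)%:C * A_ r (U' t)) ^+ k) = (fuss_moment R r k)%:C.
Proof.
have [mRe mIm] := measurable_A_power R r k.
have [intRe eqRe] := expectation_power_fun k mRe (fun x => (A_power_bound r k x).1).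
have [intIm eqIm] := expectation_power_fun k mIm (fun x => (A_power_bound r k x).2).
have ReE : (fun t => complex.Re (((U t)%:C * A_ r (U' t)) ^+ k)) =
    (fun t => U t ^+ k * complex.Re (A_ r (U' t) ^+ k)).
  by apply/funext => t; rewrite exprMn -(rmorphXn (real_complex R)) Re_mulc mul0r subr0.
have ImE : (fun t => complex.Im (((U t)%:C * A_ r (U' t)) ^+ k)) =
    (fun t => U t ^+ k * complex.Im (A_ r (U' t) ^+ k)).
  by apply/funext => t; rewrite exprMn -(rmorphXn (real_complex R)) Im_mulc mul0r addr0.
split.
  split.
  - by rewrite (_ : (fun t => _) = (fun t => (U t ^+ k * complex.Re (A_ r (U' t) ^+ k))%:E))//;
      apply/funext => t; rewrite (congr1 (@^~ t) ReE).
  - by rewrite (_ : (fun t => _) = (fun t => (U t ^+ k * complex.Im (A_ r (U' t) ^+ k))%:E))//;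
      apply/funext => t; rewrite (congr1 (@^~ t) ImE).
rewrite /cintegral ReE ImE /Rintegral eqRe eqIm.
by rewrite integral_Re_A_power integral_Im_A_power mule0.
Qed.

End ComplexRepresentation.

(** * Moments of a variable with law F *)

Section MomentsOfLaw.
Variables (R : realType) (r : nat) (F : probability (measurableTypeR R) R).
Hypotheses (hr : (0 < r)%N)
  (hF : forall k, (\int[F]_x (x ^+ k)%:E = (fuss_moment R r k)%:E)%E).
Context d (T : measurableType d) (P : probability T R).
Variable Y : {RV P >-> measurableTypeR R}.
Hypothesis lawY : eq_law (distribution P Y) F.

Lemma expectation_fuss k :
  expectation P (fun t => Y t ^+ k) = (fuss_moment R r k)%:E.
Proof.
have hG j : (\int[distribution P Y]_x (x ^+ j)%:E = (fuss_moment R r j)%:E)%E.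
  rewrite -hF; apply: eq_measure_integral => A mA _; exact: lawY.
have intG : (distribution P Y).-integrable setT (fun x => (x ^+ k)%:E).
  apply: (integrable_moment (s := fuss_unit_moment R r) (L := Lr R r)) => j.
  by rewrite hG fuss_unit_momentE.
have mk : measurable_fun setT (fun x : measurableTypeR R => (x ^+ k)%:E).
  by apply/measurable_EFinP; exact: measurable_funX.
rewrite unlock -hG integral_distribution//.
apply/integrableP; split.
  by apply: (measurableT_comp mk); exact: measurable_RV.
have /integrableP[_] := intG; rewrite ge0_integral_distribution//.
by apply: measurableT_comp.
Qed.

End MomentsOfLaw.

Theorem proposition2 (R : realType) (r : nat) (hr : (1 <= r)%N)
    (F : probability (measurableTypeR R) R)
    (hF : forall k : nat,
       (\int[F]_x (x ^+ k)%:E)%E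
         = (k.+1%:R^-1 * 'C(r.+1 * k, k)%:R)%:E) :
  (* (i) *)
  (let a : seq R[i] := [seq - (j%:R / r.+1%:R) | j <- iota 1 r] in
   let b : seq R[i] := [seq - (j%:R / r%:R) | j <- iota 1 r.-1] in
   is_hypergeometric a b (hypergeometric a b) /\
   forall z : R[i], ~ [set x%:C | x in `[0, Lr R r]] z ->
     cintegrable F (fun x : R => (z - x%:C)^-1) /\
     cauchy_transform F z
       = r.+1%:R^-1 * (1 - hypergeometric a b ((Lr R r)%:C / z)))
  /\
  forall (d : measure_display) (T : measurableType d) (P : probability T R)
    (Y : {RV P >-> measurableTypeR R}),
  eq_law (distribution P Y) F ->
  (* (ii) *)
  (forall (d' : measure_display) (T' : measurableType d')
     (Q : probability T' R) (U : {RV Q >-> measurableTypeR R})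
     (B : 'I_r -> {RV Q >-> measurableTypeR R}),
     eq_law (distribution Q U) (uniform_prob (Lr_gt0 R r)) ->
     (forall j : 'I_r,
        eq_law (distribution Q (B j))
          (beta_law (j.+1%:R / r.+1%:R) (j.+1%:R / (r%:R * r.+1%:R)))) ->
     independent Q (fun i : option 'I_r => if i is Some j then B j else U) ->
     eq_law (distribution P Y)
       (pushforward Q (fun t => U t * \prod_(j < r) B j t)))
  /\
  (* (iii) *)
  (forall (d' : measure_display) (T' : measurableType d')
     (Q : probability T' R) (U U' : {RV Q >-> measurableTypeR R}),
     eq_law (distribution Q U) (uniform_prob (@ltr01 R)) ->
     eq_law (distribution Q U') (uniform_prob (@ltr01 R)) ->
     independent Q (fun i : bool => if i then U' else U) ->
     forall k : nat,
       cintegrable Q (fun t => ((U t)%:C * A_ r (U' t)) ^+ k) /\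
       (fine 'E_P[fun t => Y t ^+ k])%:C
         = cintegral Q (fun t => ((U t)%:C * A_ r (U' t)) ^+ k)).
Proof.
have hF' k : (\int[F]_x (x ^+ k)%:E = (fuss_moment R r k)%:E)%E by exact: hF.
split; first split.
- exact: (hypergeometricP hr hF').
- exact: (cauchy_transform_fuss hr hF').
move=> d T P Y lawY; split=> [d' T' Q U B lawU lawB ind A mA|d' T' Q U U' lawU lawU' ind k].
  rewrite lawY//; exact: (product_law hr lawU lawB ind hF').
have [intA eqA] := cintegral_power_A r lawU lawU' ind k.
by split; rewrite ?eqA ?(expectation_fuss hr hF' lawY).
Qed.
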